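(* Balanced Cluster Editing restricted to instances $(G,k,\eta)$ in which $G$ is a cluster graph admits an algorithm running in time $4^{k+o(k)}\cdot n^{\mathcal{O}(1)}$, where $n=|V(G)|$.
   Context: All graphs are finite and simple. A cluster graph is a graph in which every connected component is a clique. For a non-negative integer $\eta$, a graph is $\eta$-balanced if for any two connected components $H,H'$ we have $\big||V(H)|-|V(H')|\big|\le\eta$. Balanced Cluster Editing: given a graph $G$ and non-negative integers $k,\eta$, decide whether there is $F\subseteq\binom{V(G)}{2}$ with $|F|\le k$ such that the graph $(V(G),E(G)\triangle F)$ is an $\eta$-balanced cluster graph. *)

(* Defs.v *)
From mathcomp Require Import all_boot all_order all_algebra.

Set Implicit Arguments.
Unset Strict Implicit.
Unset Printing Implicit Defensive.

Import GRing.Theory Num.Theory.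

(** A finite simple graph with vertex set [V] is given by its edge set
    [E \subset pairs V]. *)

Definition pairs (V : finType) : {set {set V}} := [set e : {set V} | #|e| == 2].

Definition adj (V : finType) (E : {set {set V}}) : rel V :=
  fun x y => [set x; y] \in E.

Definition components (V : finType) (E : {set {set V}}) : {set {set V}} :=
  [set [set y | connect (adj E) x y] | x : V].

Definition clique (V : finType) (E : {set {set V}}) (H : {set V}) : bool :=
  [forall x in H, forall y in H, (x != y) ==> adj E x y].

Definition cluster_graph (V : finType) (E : {set {set V}}) : bool :=
  [forall H in components E, clique E H].

Definition balanced (V : finType) (eta : nat) (E : {set {set V}}) : bool :=
  [forall H in components E, forall H' in components E,
     absz (#|H|%:Z - #|H'|%:Z)%R <= eta].

Definition symdiff (T : finType) (A B : {set T}) : {set T} :=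
  (A :\: B) :|: (B :\: A).

Definition balanced_cluster_editing
    (V : finType) (E : {set {set V}}) (k eta : nat) : bool :=
  [exists F : {set {set V}},
     [&& F \subset pairs V, #|F| <= k,
         cluster_graph (symdiff E F) & balanced eta (symdiff E F)]].

(** Time is measured on a unit-cost random access machine whose only
    arithmetic is addition and truncated subtraction. Multiplication is left
    out on purpose: at unit cost it would make the machine unrealistically
    powerful. Control flow is structured; replacing it by jumps changes running
    times by a constant factor only. A program mentions finitely many
    registers; the memory is addressed indirectly, through registers. *)

Record state := State { regs : nat -> nat; cells : nat -> nat }.

Inductive cmd :=
| Skip
| Const (r v : nat)
| Add (r a b : nat)
| Sub (r a b : nat)
| Read (r a : nat)
| Write (a b : nat)
| Seq (c1 c2 : cmd)
| If (a : nat) (c1 c2 : cmd)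
| While (a : nat) (c : cmd).

Definition upd (f : nat -> nat) (a v : nat) : nat -> nat :=
  fun x => if x == a then v else f x.

Definition set_reg (s : state) (r v : nat) : state :=
  State (upd (regs s) r v) (cells s).

Definition set_cell (s : state) (a v : nat) : state :=
  State (regs s) (upd (cells s) a v).

(** [exec c s t s']: started in [s], the program [c] halts in [s'] after
    exactly [t] steps. *)
Inductive exec : cmd -> state -> nat -> state -> Prop :=
| exec_skip s : exec Skip s 1 s
| exec_const r v s : exec (Const r v) s 1 (set_reg s r v)
| exec_add r a b s : exec (Add r a b) s 1 (set_reg s r (regs s a + regs s b))
| exec_sub r a b s : exec (Sub r a b) s 1 (set_reg s r (regs s a - regs s b))
| exec_read r a s : exec (Read r a) s 1 (set_reg s r (cells s (regs s a)))
| exec_write a b s : exec (Write a b) s 1 (set_cell s (regs s a) (regs s b))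
| exec_seq c1 c2 s t1 s1 t2 s2 :
    exec c1 s t1 s1 -> exec c2 s1 t2 s2 -> exec (Seq c1 c2) s (t1 + t2) s2
| exec_if_true a c1 c2 s t s' :
    regs s a <> 0 -> exec c1 s t s' -> exec (If a c1 c2) s t.+1 s'
| exec_if_false a c1 c2 s t s' :
    regs s a = 0 -> exec c2 s t s' -> exec (If a c1 c2) s t.+1 s'
| exec_while_true a c s t1 s1 t2 s2 :
    regs s a <> 0 -> exec c s t1 s1 -> exec (While a c) s1 t2 s2 ->
    exec (While a c) s (t1 + t2).+1 s2
| exec_while_false a c s :
    regs s a = 0 -> exec (While a c) s 1 s.

(** Input convention: registers 0, 1, 2 hold [n], [k], [eta]; the adjacency
    matrix is stored row by row in memory cells 0, ..., n * n - 1; everything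
    else is 0. *)
Definition input (n : nat) (E : {set {set 'I_n}}) (k eta : nat) : state :=
  State (nth 0 [:: n; k; eta])
        (fun a => [exists i : 'I_n, exists j : 'I_n,
                     (a == i * n + j) && adj E i j]).

Definition output (s : state) : nat := regs s 0.

(** [f k = o(k)]; [f] being integer valued is no restriction for upper bounds
    of the form [4 ^ (k + o(k))], since rounding up preserves [o(k)]. *)
Definition sublinear (f : nat -> nat) : Prop :=
  forall eps : rat, (0 < eps)%R ->
  exists k0 : nat, forall k : nat, k0 <= k -> ((f k)%:R <= eps * k%:R)%R.

(* Main.v *)
Require Import Defs.
From mathcomp Require Import all_boot all_order all_algebra.
From mathcomp Require Import zify.

(** Editing one cluster graph into another amounts to a sequence of moves, each
    splitting a cluster of size [x + y] into parts of sizes [x] and [y] or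
    merging two clusters of these sizes, at the price of [x * y] edits: first
    cut the clusters along the target, then join the pieces. Only the profile
    matters, i.e. the number of vertices lying in clusters of each size. A move
    is spelled by [x + y - 1 <= x * y] digits in base 4: [x - 1] and [y - 1]
    unary digits of two kinds, and one final digit that says split or merge.
    Hence every affordable sequence of moves is spelled by some number below
    [4 ^ k], and trying all of them, each in time polynomial in [n] and [k],
    solves the problem; the factor polynomial in [k] is [4 ^ O(log k)]. *)

Set Implicit Arguments.
Unset Strict Implicit.
Unset Printing Implicit Defensive.

Import Order.TTheory GRing.Theory Num.Theory.

(** * Cluster graphs, splits and merges *)

Section Clusters.
Variable V : finType.
Implicit Types (E F : {set {set V}}) (X Y H : {set V}) (u v x y z : V).

(** The cut-then-join sequence is optimal because no pair is edited twice: each move alters only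
    pairs on which the current graph and the target still differ, so the costs of the moves add up
    to exactly the number of edits. Conversely every number is harmless. Moves that the budget or
    the profile forbids are skipped, and the others are realised on an actual graph, so each decoded
    profile belongs to a cluster graph within distance [k]. Clusters of equal size are
    interchangeable and balance depends on sizes alone, which is why the graph itself can be
    forgotten. Counting vertices rather than clusters makes the profile easy to load: each vertex
    adds 1 at the size of its closed neighbourhood, and no component has to be found. The machine
    cannot multiply, so products are maintained by additions and digits are extracted by
    doubling. *)

Definition cl E x : {set V} := [set y | (y == x) || adj E x y].

(** Adjacency together with equality is an equivalence relation; symmetry and reflexivity are
    automatic. Components become closed neighbourhoods, and paths disappear from the argument. *)
Definition equiv_graph E : Prop :=
  E \subset pairs V /\
  forall x y z, y \in cl E x -> z \in cl E y -> z \in cl E x.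

Lemma adj_sym E x y : adj E x y = adj E y x.
Proof. by rewrite /adj setUC. Qed.

Lemma cl_refl E x : x \in cl E x.
Proof. by rewrite inE eqxx. Qed.

Lemma cl_sym E x y : (y \in cl E x) = (x \in cl E y).
Proof. by rewrite !inE eq_sym adj_sym. Qed.

Lemma adj_irr E x : E \subset pairs V -> adj E x x = false.
Proof.
move=> /subsetP sE; apply/negP => /sE.
by rewrite inE setUid cards1.
Qed.

Lemma adjE E x y : E \subset pairs V -> adj E x y = (x != y) && (y \in cl E x).
Proof.
move=> sE; rewrite inE; case: (eqVneq x y) => [->|ne //].
exact: adj_irr.
Qed.

Lemma equiv_cl E x y : equiv_graph E -> y \in cl E x -> cl E y = cl E x.
Proof.
move=> [_ tr] yx; apply/setP=> z; apply/idP/idP; first exact: tr.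
by apply: tr; rewrite cl_sym.
Qed.

Lemma connect_cl E x : equiv_graph E -> [set y | connect (adj E) x y] = cl E x.
Proof.
move=> gE; apply/setP=> y; rewrite inE; apply/idP/idP; last first.
  rewrite inE => /orP[/eqP->|a]; [exact: connect0 | exact: connect1].
case/connectP=> p; elim: p x => [|z p IH] x /=; first by move=> _ ->; exact: cl_refl.
case/andP=> a pa e; have zx : z \in cl E x by rewrite inE a orbT.
by rewrite -(equiv_cl gE zx); exact: IH.
Qed.

Lemma componentsE E : equiv_graph E -> components E = [set cl E x | x : V].
Proof.
by move=> gE; apply: eq_imset => x; exact: connect_cl.
Qed.

Lemma cluster_graphP E : E \subset pairs V -> cluster_graph E <-> equiv_graph E.
Proof.
move=> sE; split=> [|gE].
  move=> /forall_inP cE; split=> // x y z yx zy.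
  have conn u v : v \in cl E u -> connect (adj E) u v.
    by rewrite inE => /orP[/eqP->|a]; [exact: connect0 | exact: connect1].
  have /cE/forall_inP/(_ x) : [set y | connect (adj E) x y] \in components E.
    exact: imset_f.
  rewrite inE connect0 => /(_ isT)/forall_inP/(_ z).
  rewrite inE (connect_trans (conn _ _ yx) (conn _ _ zy)) => /(_ isT).
  by rewrite inE eq_sym; case: eqVneq.
apply/forall_inP=> H; rewrite (componentsE gE) => /imsetP[x _ ->].
apply/forall_inP=> u ux; apply/forall_inP=> v vx; apply/implyP=> uv.
by rewrite adjE // uv (equiv_cl gE ux).
Qed.

Lemma balancedP eta E : equiv_graph E ->
  reflect (forall x y, #|cl E x| <= #|cl E y| + eta) (balanced eta E).
Proof.
move=> gE; rewrite /balanced (componentsE gE).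
apply: (iffP forall_inP) => [b x y|b H /imsetP[x _ ->]].
  have /forall_inP/(_ (cl E y)) := b _ (imset_f (cl E) (isT : x \in V)).
  by move=> /(_ (imset_f (cl E) (isT : y \in V))); lia.
apply/forall_inP=> H' /imsetP[y _ ->].
by have := b x y; have := b y x; lia.
Qed.

Lemma equiv_graph_inj E F : equiv_graph E -> equiv_graph F ->
  (forall x, cl E x = cl F x) -> E = F.
Proof.
move=> [sE _] [sF _] eqc; apply/setP=> e.
have [ep|nep] := boolP (e \in pairs V); last first.
  have nmem (A : {set {set V}}) : A \subset pairs V -> e \in A = false.
    by move=> /subsetP sA; apply: contraNF nep; exact: sA.
  by rewrite !nmem.
move: ep; rewrite inE => /cards2P[a [b [ab ->]]].
have := adjE a b sE; have := adjE a b sF.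
by rewrite /adj eqc => -> ->.
Qed.

Definition cross X Y : {set {set V}} := [set [set a; b] | a in X, b in Y].

Lemma mem_cross X Y u v :
  ([set u; v] \in cross X Y) = (u \in X) && (v \in Y) || (v \in X) && (u \in Y).
Proof.
apply/imset2P/orP => [[a b aX bY e]|[|] /andP[uX vY]]; last 2 first.
- by exists u v.
- by exists v u => //; rewrite setUC.
have: a \in [set u; v] by rewrite e set21.
have: b \in [set u; v] by rewrite e set22.
have: u \in [set a; b] by rewrite -e set21.
have: v \in [set a; b] by rewrite -e set22.
rewrite !inE.
by do 4![case/orP=> /eqP ?; subst]; rewrite ?aX ?bY; auto.
Qed.

Lemma card_cross X Y : [disjoint X & Y] -> #|cross X Y| = #|X| * #|Y|.
Proof.
move=> dXY; rewrite /cross curry_imset2X card_in_imset ?cardsX //.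
move=> [a b] [a' b']; rewrite !inE /= => /andP[aX bY] /andP[aX' bY'] e.
have ne c d : c \in X -> d \in Y -> c == d = false.
  by move=> cX dY; apply/eqP=> cd; move: (disjointFr dXY cX); rewrite cd dY.
have : a \in [set a'; b'] by rewrite -e set21.
have : b \in [set a'; b'] by rewrite -e set22.
by rewrite !inE (ne a b') // (eq_sym b) (ne a' b) // orbF => /eqP-> /eqP->.
Qed.

Lemma cross_pairs X Y : [disjoint X & Y] -> cross X Y \subset pairs V.
Proof.
move=> dXY; apply/subsetP=> _ /imset2P[a b aX bY ->]; rewrite inE cards2.
by case: (eqVneq a b) => // ab; move: (disjointFr dXY aX); rewrite ab bY.
Qed.

(** One relation serves both moves: from [E] to [E1] it is a split, from [E1] to [E] a merge. *)
Definition splits E E1 X Y : Prop :=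
  [/\ [disjoint X & Y],
      forall u, cl E1 u = if u \in X then X else if u \in Y then Y else cl E u
    & forall u, u \in X :|: Y -> cl E u = X :|: Y].

Lemma cl_setD E X Y u : cl (E :\: cross X Y) u =
  [set v in cl E u | (v == u) || ~~ ((u \in X) && (v \in Y) || (v \in X) && (u \in Y))].
Proof.
apply/setP=> v; rewrite !inE /adj inE mem_cross.
by case: (v == u) => //=; rewrite andbC.
Qed.

Lemma cl_setU E X Y u : cl (E :|: cross X Y) u =
  [set v | (v \in cl E u) || ((u \in X) && (v \in Y) || (v \in X) && (u \in Y))].
Proof. by apply/setP=> v; rewrite !inE /adj inE mem_cross orbA. Qed.

Lemma split_graph E X Y u : equiv_graph E -> [disjoint X & Y] ->
  cl E u = X :|: Y ->
  equiv_graph (E :\: cross X Y) /\ splits E (E :\: cross X Y) X Y.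
Proof.
move=> gE dXY clu; set E1 := _ :\: _.
have clH v : v \in X :|: Y -> cl E v = X :|: Y.
  by rewrite -clu; exact: equiv_cl.
have cl1 v : cl E1 v = if v \in X then X else if v \in Y then Y else cl E v.
  rewrite cl_setD; apply/setP=> w; rewrite in_set.
  have [vX|vX] := boolP (v \in X).
    rewrite clH ?inE ?vX // (disjointFr dXY vX) andbF orbF.
    have [-> |] := eqVneq w v; first by rewrite vX.
    have [wX|] := boolP (w \in X); first by rewrite (disjointFr dXY wX).
    by case: (w \in Y).
  have [vY|vY] := boolP (v \in Y).
    rewrite clH ?inE ?vY ?orbT //= andbT.
    have [-> |] := eqVneq w v; first by rewrite vY orbT.
    have [wX|] := boolP (w \in X); first by rewrite (disjointFr dXY wX).
    by case: (w \in Y).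
  by rewrite !andbF !orbT andbT.
split; last by split.
split; first by apply: subset_trans (subsetDl _ _) gE.1.
move=> x y z; rewrite !cl1; case: ifP => xX; first by move=> ->.
case: ifP => xY; first by move=> yY; rewrite (disjointFl dXY yY) yY.
move=> yx; suff yH : y \notin X :|: Y.
  move: yH; rewrite inE negb_or => /andP[/negbTE-> /negbTE->].
  by apply: gE.2 yx.
apply/negP=> yH; move: (clH _ yH) => e.
have : x \in cl E y by rewrite cl_sym.
by rewrite e inE xX xY.
Qed.

Lemma merge_graph E1 u v : equiv_graph E1 -> v \notin cl E1 u ->
  let X := cl E1 u in let Y := cl E1 v in
  [/\ equiv_graph (E1 :|: cross X Y), splits (E1 :|: cross X Y) E1 X Y
    & [disjoint X & Y]].
Proof.
move=> gE vu X Y.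
have dXY : [disjoint X & Y].
  rewrite disjoint_subset; apply/subsetP=> w wX; rewrite inE.
  apply/negP=> wY; move: vu; rewrite -(equiv_cl gE wX) (equiv_cl gE wY).
  by rewrite cl_refl.
have clX w : w \in X -> cl E1 w = X by apply: equiv_cl.
have clY w : w \in Y -> cl E1 w = Y by apply: equiv_cl.
set E := _ :|: _.
have clE w : cl E w = if w \in X :|: Y then X :|: Y else cl E1 w.
  rewrite cl_setU; apply/setP=> z; rewrite in_set.
  rewrite in_setU; have [wX|wX] /= := boolP (w \in X).
    by rewrite clX // (disjointFr dXY wX) andbF orbF in_setU.
  have [wY|wY] := boolP (w \in Y).
    by rewrite clY // andbT in_setU orbC.
  by rewrite andbF orbF.
split=> //.
- split; first by rewrite subUset gE.1 cross_pairs.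
  move=> x y z; rewrite !clE; case: ifP => xH; first by move=> ->.
  move=> yx; suff /negbTE-> : y \notin X :|: Y by apply: gE.2 yx.
  apply/negP; rewrite in_setU => /orP[/clX|/clY] e.
    have : x \in cl E1 y by rewrite cl_sym.
    by rewrite e => xX; move: xH; rewrite in_setU xX.
  have : x \in cl E1 y by rewrite cl_sym.
  by rewrite e => xX; move: xH; rewrite in_setU xX orbT.
- split=> // w; rewrite ?clE; last by move=> ->.
  case: ifP => [/clX//|wX]; case: ifP => [/clY//|wY].
  by rewrite in_setU wX wY.
Qed.

Definition prof E (s : nat) : nat := #|[set u | #|cl E u| == s]|.

Lemma profE E s : prof E s = \sum_u (#|cl E u| == s).
Proof. by rewrite /prof cardsE -sum1_card big_mkcond. Qed.

Lemma prof_gt0 E x : 0 < prof E #|cl E x|.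
Proof. by rewrite /prof; apply/card_gt0P; exists x; rewrite inE. Qed.

Lemma prof_exists E s : 0 < prof E s -> exists x, #|cl E x| = s.
Proof. by case/card_gt0P=> x; rewrite inE => /eqP; exists x. Qed.

(** Vertices outside [X :|: Y] keep their class and cancel. The additive form avoids truncated
    subtraction and covers parts of equal size. *)
Lemma splits_prof E E1 X Y s : splits E E1 X Y ->
  prof E s + (s == #|X|) * #|X| + (s == #|Y|) * #|Y| =
  prof E1 s + (s == #|X| + #|Y|) * (#|X| + #|Y|).
Proof.
move=> [dXY c1 c]; have cXY : #|X :|: Y| = #|X| + #|Y|.
  by rewrite cardsU (disjoint_setI0 dXY) cards0 subn0.
have sumX (Z : {set V}) (t : nat) : \sum_(u in Z) (t == s) = (s == t) * #|Z|.
  by rewrite sum_nat_const (eq_sym t) mulnC.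
rewrite !profE (bigID (mem (X :|: Y))) /=.
rewrite [\sum_u (#|cl E1 u| == s)](bigID (mem (X :|: Y))) /=.
rewrite (eq_bigr (fun=> nat_of_bool (#|X| + #|Y| == s))); last first.
  by move=> u uH; rewrite c // cXY.
rewrite sumX cXY.
have -> : \sum_(u in X :|: Y) (#|cl E1 u| == s) =
    (s == #|X|) * #|X| + (s == #|Y|) * #|Y|.
  rewrite (eq_bigl [predU X & Y]) => [|u]; last by rewrite !inE.
  rewrite bigU //=; congr (_ + _); rewrite -sumX; apply: eq_bigr => u uZ.
    by rewrite c1 uZ.
  by rewrite c1 uZ (disjointFl dXY uZ).
rewrite [X in _ = _ + X + _](eq_bigr (fun u => nat_of_bool (#|cl E u| == s))).
  lia.
by move=> u; rewrite in_setU negb_or c1 => /andP[/negbTE-> /negbTE->].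
Qed.

(** * Distances between edge sets and the choice of a move *)

Lemma symdiff_triangle (T : finType) (A B C : {set T}) :
  #|symdiff A C| <= #|symdiff A B| + #|symdiff B C|.
Proof.
apply: leq_trans (leq_card_setU _ _).
apply/subset_leq_card/subsetP=> x; rewrite !inE.
by case: (x \in A); case: (x \in B); case: (x \in C).
Qed.

Lemma symdiffK (T : finType) (A B : {set T}) : symdiff A (symdiff A B) = B.
Proof. by apply/setP=> x; rewrite !inE; case: (x \in A); case: (x \in B). Qed.

(** Here [B] lies on a geodesic from [A] to [C], so the triangle inequality is an equality. This
    makes the costs of successive moves additive. *)
Lemma card_symdiff_step (T : finType) (A B C : {set T}) :
  symdiff A B \subset symdiff A C ->
  #|symdiff A C| = #|symdiff A B| + #|symdiff B C|.
Proof.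
move=> sub.
have -> : symdiff B C = symdiff A C :\: symdiff A B.
  apply/setP=> x; move: (subsetP sub x); rewrite !inE.
  by case: (x \in A); case: (x \in B); case: (x \in C) => // /(_ isT).
by rewrite cardsD (setIidPr sub) subnKC // subset_leq_card.
Qed.

Lemma symdiff_cross_setD E X Y u : equiv_graph E -> [disjoint X & Y] ->
  cl E u = X :|: Y -> symdiff E (E :\: cross X Y) = cross X Y.
Proof.
move=> gE dXY clu; have /subsetP sub : cross X Y \subset E.
  apply/subsetP=> _ /imset2P[a b aX bY ->].
  have := adjE a b gE.1; rewrite /adj => ->.
  rewrite (@equiv_cl _ u) // clu ?inE ?aX ?bY ?orbT ?andbT //.
  by apply/eqP=> ab; move: (disjointFr dXY aX); rewrite ab bY.
apply/setP=> e; move: (sub e); rewrite !inE.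
by case: (e \in cross X Y); case: (e \in E) => // /(_ isT).
Qed.

Lemma symdiff_cross_setU E u v : equiv_graph E -> v \notin cl E u ->
  symdiff E (E :|: cross (cl E u) (cl E v)) = cross (cl E u) (cl E v).
Proof.
move=> gE vu; set K := cross _ _.
have sub e : e \in K -> e \notin E.
  move=> /imset2P[a b aX bY ->].
  have := adjE a b gE.1; rewrite /adj => ->.
  rewrite (equiv_cl gE aX); apply/negP=> /andP[_ bX].
  by move: vu; rewrite -(equiv_cl gE bX) (equiv_cl gE bY) cl_refl.
apply/setP=> e; move: (sub e); rewrite !inE.
by case: (e \in K); case: (e \in E) => // /(_ isT).
Qed.

(* As long as some class of [E] meets two classes of [E'] it can be cut along
   [E']; otherwise [E] refines [E'] and two classes of [E] can be joined inside
   a class of [E']. *)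
Lemma exists_move E E' : equiv_graph E -> equiv_graph E' -> E != E' ->
  (exists X Y u, [/\ [disjoint X & Y], X != set0, Y != set0, cl E u = X :|: Y
     & cross X Y \subset symdiff E E']) \/
  (exists u v, v \notin cl E u /\
     cross (cl E u) (cl E v) \subset symdiff E E').
Proof.
move=> gE gE' neq.
have [/forallP sub|] := boolP [forall x, cl E x \subset cl E' x]; last first.
  case/forallPn=> u /subsetPn[v vu vu']; left.
  (* Every pair between the two parts is an edge of [E] but not of [E'], since exactly one of its
     ends lies in the class [cl E' u]. *)
  exists (cl E u :&: cl E' u), (cl E u :\: cl E' u), u.
  split.
  - by rewrite -setI_eq0; apply/eqP/setP=> w; rewrite !inE; do 2!case: (_ || _).
  - by apply/set0Pn; exists u; rewrite in_setI !cl_refl.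
  - by apply/set0Pn; exists v; rewrite in_setD vu vu'.
  - by rewrite setID.
  apply/subsetP=> _ /imset2P[a b + + ->].
  rewrite in_setI in_setD => /andP[aE aE'] /andP[bE' bE].
  have ab : a != b by apply/eqP=> ab; move: bE'; rewrite -ab aE'.
  have := adjE a b gE.1; have := adjE a b gE'.1; rewrite /adj !in_setU !in_setD.
  by rewrite (equiv_cl gE aE) (equiv_cl gE' aE') (negbTE bE') bE ab => -> ->.
right; have /forallPn[u] : ~~ [forall x, cl E' x \subset cl E x].
  apply: contra neq => /forallP sub'; apply/eqP; apply: equiv_graph_inj => // x.
  by apply/eqP; rewrite eqEsubset sub sub'.
case/subsetPn=> v vu' vu; exists u, v; split=> //.
apply/subsetP=> _ /imset2P[a b aX bY ->].
have bu : b \notin cl E u.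
  apply: contra vu => bu; rewrite -(equiv_cl gE bu) (equiv_cl gE bY).
  exact: cl_refl.
have ab : a != b by apply: contraNneq bu => <-.
have aX' := subsetP (sub u) _ aX; have bY' := subsetP (sub v) _ bY.
have := adjE a b gE.1; have := adjE a b gE'.1; rewrite /adj !in_setU !in_setD.
rewrite (equiv_cl gE aX) (equiv_cl gE' aX') (negbTE bu) ab -(equiv_cl gE' vu').
by rewrite bY' => -> ->.
Qed.

End Clusters.

(** * Spelling sequences of moves by base-4 digits *)

Definition incr (f : nat -> nat) (a d : nat) : nat -> nat := upd f a (f a + d).
Definition decr (f : nat -> nat) (a d : nat) : nat -> nat := upd f a (f a - d).

Lemma incrE f a d s : incr f a d s = f s + (s == a) * d.
Proof. by rewrite /incr /upd; case: eqP => [->|_]; rewrite ?mul1n ?addn0. Qed.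

Lemma decrE f a d s : decr f a d s = f s - (s == a) * d.
Proof. by rewrite /decr /upd; case: eqP => [->|_]; rewrite ?mul1n ?subn0. Qed.

Definition split_prof f x y : nat -> nat :=
  incr (incr (decr f (x + y) (x + y)) x x) y y.

Definition merge_prof f x y : nat -> nat :=
  incr (decr (decr f x x) y y) (x + y) (x + y).

Definition can_split (f : nat -> nat) x y : bool := f (x + y) != 0.

(** Taking out the first cluster before looking for the second matters when [x = y]: two clusters of
    that size are then needed. *)
Definition can_merge (f : nat -> nat) x y : bool :=
  (f x != 0) && (decr f x x y != 0).

(** [cnt s] is the number of vertices in clusters of size [s], [bud] the
    remaining budget and [(cx, cy)] the sizes of the move being spelled. *)
Record conf := Conf { cnt : nat -> nat; bud : nat; cx : nat; cy : nat }.

(** The digits [(true, _)] spell the sizes in unary and [(false, m)] executes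
    the spelled move. A move [(x, y)] costs [x * y] edits and needs [x + y - 1]
    digits, which is at most [x * y]. *)
Definition dstep (c : conf) (d : bool * bool) : conf :=
  let: Conf f b x y := c in
  match d with
  | (true, true) => Conf f b x y.+1
  | (true, false) => Conf f b x.+1 y
  | (false, false) =>
      if (x * y <= b) && can_split f x y
      then Conf (split_prof f x y) (b - x * y) 1 1 else Conf f b 1 1
  | (false, true) =>
      if (x * y <= b) && can_merge f x y
      then Conf (merge_prof f x y) (b - x * y) 1 1 else Conf f b 1 1
  end.

(** * Soundness and completeness of spelled moves *)

Section Moves.
Variable V : finType.
Implicit Types (E F : {set {set V}}) (X Y : {set V}).

(** Nonempty parts are strictly smaller than their union, so [splits_prof] guarantees enough
    vertices of the size being decreased and truncation does no harm. *)
Lemma splits_split_prof E E1 X Y s : splits E E1 X Y ->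
  X != set0 -> Y != set0 -> prof E1 s = split_prof (prof E) #|X| #|Y| s.
Proof.
move=> /(splits_prof s) e; rewrite -!card_gt0 => x0 y0.
by rewrite /split_prof !incrE decrE; lia.
Qed.

Lemma splits_merge_prof E E1 X Y s : splits E E1 X Y ->
  X != set0 -> Y != set0 -> prof E s = merge_prof (prof E1) #|X| #|Y| s.
Proof.
move=> /(splits_prof s) e; rewrite -!card_gt0 => x0 y0.
by rewrite /merge_prof !incrE !decrE; lia.
Qed.

Lemma splits_can_merge E E1 X Y : splits E E1 X Y ->
  X != set0 -> Y != set0 -> can_merge (prof E1) #|X| #|Y|.
Proof.
move=> sp; rewrite -!card_gt0 => x0 y0.
have := splits_prof #|X| sp; have := splits_prof #|Y| sp.
by rewrite /can_merge !decrE; lia.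
Qed.

Lemma splits_can_split E E1 X Y : splits E E1 X Y ->
  X != set0 -> Y != set0 -> can_split (prof E) #|X| #|Y|.
Proof.
move=> sp; rewrite -!card_gt0 => x0 y0.
by have := splits_prof (#|X| + #|Y|) sp; rewrite /can_split; lia.
Qed.

Lemma subset_of_card (T : finType) (H : {set T}) x : x <= #|H| ->
  exists2 X : {set T}, X \subset H & #|X| = x.
Proof.
move=> xH; exists [set:: take x (enum H)].
  by apply/subsetP=> u; rewrite inE => /mem_take; rewrite mem_enum.
rewrite cardsE; have /card_uniqP-> : uniq (take x (enum H)).
  by apply: take_uniq; exact: enum_uniq.
by rewrite size_takel // -cardE.
Qed.

(** A nonzero count at [x + y] provides a class of that size, and any [x] of its vertices may be cut
    off. *)
Lemma split_sound E (x y : nat) : equiv_graph E -> 0 < x -> 0 < y ->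
  can_split (prof E) x y -> exists E1,
  [/\ equiv_graph E1, #|symdiff E E1| = x * y
    & prof E1 =1 split_prof (prof E) x y].
Proof.
move=> gE x0 y0; rewrite /can_split -lt0n => /prof_exists[u cu].
have [|X sX cX] := @subset_of_card _ (cl E u) x; first by lia.
have eH : cl E u = X :|: (cl E u :\: X).
  by rewrite -{1}(setID (cl E u) X) (setIidPr sX).
have dXY : [disjoint X & cl E u :\: X].
  by rewrite -setI_eq0 setIDA setIC -setIDA setDv setI0.
have cY : #|cl E u :\: X| = y by rewrite cardsD (setIidPr sX); lia.
move: eH dXY cY; set Y := _ :\: X => eH dXY cY.
have [gE1 sp] := split_graph gE dXY eH.
exists (E :\: cross X Y); split=> //.
  by rewrite (symdiff_cross_setD gE dXY eH) card_cross // cX cY.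
by move=> s; rewrite -cX -cY; apply: splits_split_prof sp _ _; rewrite -card_gt0; lia.
Qed.

Lemma merge_sound E (x y : nat) : equiv_graph E -> 0 < x -> 0 < y ->
  can_merge (prof E) x y -> exists E1,
  [/\ equiv_graph E1, #|symdiff E E1| = x * y
    & prof E1 =1 merge_prof (prof E) x y].
Proof.
move=> gE x0 y0 /andP[]; rewrite -lt0n => /prof_exists[u cu] nz.
have [v cv vu] : exists2 v, #|cl E v| = y & v \notin cl E u.
  have [v] : exists v, v \in [set v | #|cl E v| == y] :\: cl E u.
    apply/set0Pn; rewrite -card_gt0 cardsD.
    (* If the sizes differ, no candidate lies in [cl E u]. If they agree, there are more than [x]
       candidates, of which at most [x] lie in [cl E u]. *)
    have [exy|nxy] := eqVneq x y; last first.
      rewrite [_ :&: _](_ : _ = set0) ?cards0.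
        by move: nz; rewrite decrE /prof; lia.
      apply/setP=> w; rewrite in_setI in_set0 in_set; apply/negP=> /andP[/eqP cw wu].
      by move: cw; rewrite (equiv_cl gE wu) cu => /eqP; rewrite (negbTE nxy).
    have := subset_leq_card (subsetIr [set v | #|cl E v| == y] (cl E u)).
    by move: nz; rewrite decrE /prof; lia.
  by rewrite in_setD in_set => /andP[? /eqP ?]; exists v.
have [gE1 sp dXY] := merge_graph gE vu.
exists (E :|: cross (cl E u) (cl E v)); split=> //.
  by rewrite symdiff_cross_setU // card_cross // cu cv.
move=> s; rewrite -cu -cv; apply: splits_merge_prof sp _ _.
  by rewrite -card_gt0 cu.
by rewrite -card_gt0 cv.
Qed.

Lemma eq_split_prof f g x y : f =1 g -> split_prof f x y =1 split_prof g x y.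
Proof. by move=> fg s; rewrite /split_prof !incrE !decrE fg. Qed.

Lemma eq_merge_prof f g x y : f =1 g -> merge_prof f x y =1 merge_prof g x y.
Proof. by move=> fg s; rewrite /merge_prof !incrE !decrE fg. Qed.

Lemma eq_can_merge f g x y : f =1 g -> can_merge f x y = can_merge g x y.
Proof. by move=> fg; rewrite /can_merge !decrE !fg. Qed.

Definition reaches E k (c : conf) : Prop :=
  [/\ 0 < cx c, 0 < cy c & exists E',
    [/\ equiv_graph E', cnt c =1 prof E' & #|symdiff E E'| + bud c <= k]].

(** No assumption is made on the digit: an infeasible move only resets the sizes, and a feasible one
    takes from the budget what the triangle inequality adds to the distance. *)
Lemma dstep_reaches E k c d : reaches E k c -> reaches E k (dstep c d).
Proof.
case: c => f b x y; rewrite {1}/reaches /= => -[x0 y0 [E' [gE' fE' cost]]].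
case: d => [[] []] /=; try by split=> //; exists E'.
  case: ifP => [/andP[xyb]|_]; last by split=> //; exists E'.
  rewrite (eq_can_merge _ _ fE') => /(merge_sound gE' x0 y0)[E1 [gE1 d1 p1]].
  split=> //; exists E1; split=> //= [s|].
    by rewrite p1 (eq_merge_prof _ _ fE').
  by apply: leq_trans (leq_add (symdiff_triangle E E' E1) (leqnn _)) _; rewrite d1 -addnA subnKC.
case: ifP => [/andP[xyb]|_]; last by split=> //; exists E'.
rewrite /can_split fE' => /(split_sound gE' x0 y0)[E1 [gE1 d1 p1]].
split=> //; exists E1; split=> //= [s|].
  by rewrite p1 (eq_split_prof _ _ fE').
by apply: leq_trans (leq_add (symdiff_triangle E E' E1) (leqnn _)) _; rewrite d1 -addnA subnKC.
Qed.

Definition spell x y m : seq (bool * bool) :=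
  nseq x.-1 (true, false) ++ nseq y.-1 (true, true) ++ [:: (false, m)].

(** This is [(x - 1) * (y - 1) >= 0]. *)
Lemma size_spell x y m : 0 < x -> 0 < y -> size (spell x y m) <= x * y.
Proof. by move=> ? ?; rewrite /spell !size_cat !size_nseq /=; nia. Qed.

Lemma foldl_spell f b x y m : 0 < x -> 0 < y ->
  foldl dstep (Conf f b 1 1) (spell x y m) = dstep (Conf f b x y) (false, m).
Proof.
move=> x0 y0; rewrite /spell !foldl_cat.
have hx i j : foldl dstep (Conf f b i 1) (nseq j (true, false)) = Conf f b (i + j) 1.
  by elim: j i => [|j IH] i /=; rewrite ?addn0 ?IH ?addSnnS.
have hy l i j : foldl dstep (Conf f b l i) (nseq j (true, true)) = Conf f b l (i + j).
  by elim: j i => [|j IH] i /=; rewrite ?addn0 ?IH ?addSnnS.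
by rewrite hx hy !add1n !prednK.
Qed.

(** Strong induction on the budget: a move towards [E'] has positive cost, shortens the distance by
    exactly this cost, and its spelling is no longer than its cost. *)
Lemma dstep_complete E E' f b : equiv_graph E -> equiv_graph E' ->
  f =1 prof E -> #|symdiff E E'| <= b ->
  exists2 ds, size ds <= b & cnt (foldl dstep (Conf f b 1 1) ds) =1 prof E'.
Proof.
elim/ltn_ind: b E f => b IH E f gE gE' fE dE.
have [<-|neq] := eqVneq E E'; first by exists [::].
suff [x [y [m [E1 [f1 [x0 y0 gE1 f1E1]]]]]] : exists x y m E1 f1,
    [/\ 0 < x, 0 < y, equiv_graph E1, f1 =1 prof E1 &
     #|symdiff E1 E'| + x * y <= b /\
     dstep (Conf f b x y) (false, m) = Conf f1 (b - x * y) 1 1].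
  move=> [cost st].
  have [||ds sds res] := IH (b - x * y) _ E1 f1 gE1 gE' f1E1; try by nia.
  exists (spell x y m ++ ds); last by rewrite foldl_cat foldl_spell // st.
  by rewrite size_cat; have := size_spell m x0 y0; nia.
have [[X [Y [u [dXY X0 Y0 cu sub]]]]|[u [v [vu sub]]]] := exists_move gE gE' neq.
  have [gE1 sp] := split_graph gE dXY cu.
  exists #|X|, #|Y|, false, (E :\: cross X Y), (split_prof f #|X| #|Y|).
  rewrite !card_gt0; have eD := symdiff_cross_setD gE dXY cu.
  have := @card_symdiff_step _ E (E :\: cross X Y) E'; rewrite eD card_cross //.
  move=> /(_ sub) cost; split=> //.
    move=> s; rewrite (eq_split_prof _ _ fE).
    by rewrite (splits_split_prof _ sp).
  split; first by rewrite addnC -cost.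
  rewrite /= /can_split fE [prof E _ != 0](splits_can_split sp) // andbT.
  by rewrite ifT //; apply: leq_trans dE; rewrite cost leq_addr.
have [gE1 sp dXY] := merge_graph gE vu.
set X := cl E u in sub gE1 sp dXY *; set Y := cl E v in sub gE1 sp dXY *.
have X0 : X != set0 by apply/set0Pn; exists u; exact: cl_refl.
have Y0 : Y != set0 by apply/set0Pn; exists v; exact: cl_refl.
exists #|X|, #|Y|, true, (E :|: cross X Y), (merge_prof f #|X| #|Y|).
rewrite !card_gt0; have eD := symdiff_cross_setU gE vu.
have := @card_symdiff_step _ E (E :|: cross X Y) E'; rewrite eD card_cross //.
move=> /(_ sub) cost; split=> //.
  move=> s; rewrite (eq_merge_prof _ _ fE).
  by rewrite (splits_merge_prof _ sp).
split; first by rewrite addnC -cost.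
rewrite /= (eq_can_merge _ _ fE) (splits_can_merge sp) // andbT.
by rewrite ifT //; apply: leq_trans dE; rewrite cost leq_addr.
Qed.

Lemma dstep_complete_exact E E' f b : equiv_graph E -> equiv_graph E' ->
  f =1 prof E -> #|symdiff E E'| <= b ->
  exists2 ds, size ds = b & cnt (foldl dstep (Conf f b 1 1) ds) =1 prof E'.
Proof.
move=> gE gE' fE dE; have [ds sds res] := dstep_complete gE gE' fE dE.
exists (ds ++ nseq (b - size ds) (true, false)).
  by rewrite size_cat size_nseq; lia.
rewrite foldl_cat; move: res; case: (foldl _ _ ds) => g b' x y /= res.
by elim: (b - size ds) x => //= i IH x; exact: IH.
Qed.

End Moves.

(** * Decoding numbers into digit strings *)

Section Digits.
Variable M : nat.

(* The top bit of a number below [M], where [M] is a power of two, is obtained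
   by doubling. *)
Definition top_bit w : bool := M <= w + w.
Definition shift w : nat := w + w - top_bit w * M.

Fixpoint interp i w (c : conf) : conf :=
  if i is i'.+1 then
    interp i' (shift (shift w)) (dstep c (top_bit w, top_bit (shift w)))
  else c.

Lemma interp_reaches (V : finType) (E : {set {set V}}) k i w c :
  reaches E k c -> reaches E k (interp i w c).
Proof. by elim: i w c => //= i IH w c rc; apply/IH/dstep_reaches. Qed.

Fixpoint number (ds : seq (bool * bool)) : nat :=
  if ds is (u, v) :: ds' then (u.*2 + v) * 4 ^ size ds' + number ds' else 0.

Lemma number_lt ds : number ds < 4 ^ size ds.
Proof.
elim: ds => [|[u v] ds IH] //=; rewrite expnS.
by case: u; case: v => /=; lia.
Qed.

(** The factor [4 ^ j] accounts for [j] digits already read: each reading shifts the rest to the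
    left while [M] stays fixed. *)
Lemma interp_number ds j c : M = 4 ^ (j + size ds) ->
  interp (size ds) (4 ^ j * number ds) c = foldl dstep c ds.
Proof.
elim: ds j c => [|[u v] ds IH] j c //= eM.
set w := 4 ^ j * _.
have lt := number_lt ds; have j0 : 0 < 4 ^ j by rewrite expn_gt0.
have eM' : M = 4 * (4 ^ j * 4 ^ size ds) by rewrite eM addnS expnS expnD.
have lt2 : 4 ^ j * number ds < 4 ^ j * 4 ^ size ds by rewrite ltn_pmul2l.
have ew : w = u.*2 * (4 ^ j * 4 ^ size ds) + v * (4 ^ j * 4 ^ size ds) + 4 ^ j * number ds.
  by rewrite /w; case: (u); case: (v) => /=; lia.
have [tu tv sv] : [/\ top_bit w = u, top_bit (shift w) = v &
    shift (shift w) = 4 * (4 ^ j * number ds)].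
  move: (4 ^ j * 4 ^ size ds) (4 ^ j * number ds) w ew lt2 eM' => A B w ew lt2 eM'.
  have tu : top_bit w = u by rewrite /top_bit eM' ew; case: (u); case: (v) => /=; lia.
  have su : shift w = v.*2 * A + B.*2.
    by rewrite /shift tu eM' ew; case: (u); case: (v) => /=; lia.
  have tv : top_bit (shift w) = v by rewrite /top_bit eM' su; case: (v) => /=; lia.
  by split=> //; rewrite /shift -/(shift w) tv eM' su; case: (v) => /=; lia.
by rewrite tv tu sv mulnA -expnS IH // eM addSnnS.
Qed.
End Digits.

(** * Correctness of the search over all numbers *)

Definition good (n eta : nat) (f : nat -> nat) : bool :=
  all (fun s => all (fun s' => (f s != 0) ==> (f s' != 0) ==> (s <= s' + eta))
    (iota 1 n)) (iota 1 n).

Section Correctness.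
Variables (n : nat) (E : {set {set 'I_n}}) (k eta : nat).

Lemma card_cl_bounds (F : {set {set 'I_n}}) u : 1 <= #|cl F u| <= n.
Proof.
rewrite card_gt0 -[X in _ <= X](card_ord n) max_card andbT.
by apply/set0Pn; exists u; exact: cl_refl.
Qed.

Lemma prof_large (F : {set {set 'I_n}}) s : n < s -> prof F s = 0.
Proof.
move=> ns; apply/eqP; rewrite -leqn0 leqNgt; apply/negP=> /prof_exists[u cu].
by have := card_cl_bounds F u; rewrite cu; lia.
Qed.

Lemma good_balanced (F : {set {set 'I_n}}) f : equiv_graph F -> f =1 prof F ->
  good n eta f = balanced eta F.
Proof.
move=> gF fF; apply/allP/(balancedP eta gF) => [g x y|b s _].
  have mem u : #|cl F u| \in iota 1 n.
    by rewrite mem_iota; have := card_cl_bounds F u; lia.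
  have /allP/(_ _ (mem y)) := g _ (mem x).
  by rewrite !fF -!lt0n !prof_gt0.
apply/allP=> s' _; rewrite !fF -!lt0n.
apply/implyP=> /prof_exists[x <-]; apply/implyP=> /prof_exists[y <-].
exact: b.
Qed.

(** From left to right a solution is turned into the number spelling a route to it. From right to
    left any number will do: its decoded profile is that of a cluster graph [F] within distance [k],
    and [symdiff E F] is the required edit set. *)
Lemma editing_interp : E \subset pairs 'I_n -> cluster_graph E ->
  balanced_cluster_editing E k eta =
  has (fun N => good n eta (cnt (interp (4 ^ k) k N (Conf (prof E) k 1 1))))
    (iota 0 (4 ^ k)).
Proof.
move=> sE /(cluster_graphP sE) gE; apply/existsP/hasP.
  move=> [F /and4P[sF cF clF bF]].
  have sEF : symdiff E F \subset pairs 'I_n.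
    rewrite /symdiff subUset (subset_trans (subsetDl _ _) sE).
    exact: subset_trans (subsetDl _ _) sF.
  have gF : equiv_graph (symdiff E F) by apply/cluster_graphP.
  have [||ds sds res] := @dstep_complete_exact _ _ _ (prof E) k gE gF.
  - by [].
  - by rewrite symdiffK.
  exists (number ds); first by rewrite mem_iota -sds number_lt.
  rewrite (@good_balanced (symdiff E F)) // => s.
  by rewrite -{2}sds -[number ds]mul1n -[1]/(4 ^ 0) interp_number ?add0n ?sds.
move=> [N _]; have : reaches E k (Conf (prof E) k 1 1).
  split=> //; exists E; split=> //=.
  by rewrite /symdiff setDv setU0 cards0.
case/(interp_reaches (4 ^ k) k N)=> _ _ [F [gF fF cost]].
rewrite (good_balanced gF fF) => bF; exists (symdiff E F).
rewrite symdiffK bF; apply/and4P; split=> //.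
- rewrite /symdiff subUset (subset_trans (subsetDl _ _) sE).
  exact: subset_trans (subsetDl _ _) gF.1.
- exact: leq_trans (leq_addr _ _) cost.
- by apply/(cluster_graphP gF.1).
Qed.

Definition matrix_cell (a : nat) : nat :=
  [exists i : 'I_n, exists j : 'I_n, (a == i * n + j) && adj E i j].

Lemma matrix_cellE (i j : 'I_n) : matrix_cell (i * n + j) = adj E i j.
Proof.
rewrite /matrix_cell; congr nat_of_bool; apply/existsP/idP => [[i'] | a]; last first.
  by exists i; apply/existsP; exists j; rewrite eqxx.
case/existsP=> j' /andP[/eqP e].
have n0 : 0 < n by have := ltn_ord i; lia.
have ei : i = i' :> nat.
  have := congr1 (divn^~ n) e.
  by rewrite !divnMDl // !divn_small // !addn0.
have ej : j = j' :> nat by move: e; rewrite ei; lia.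
by rewrite (val_inj ei) (val_inj ej).
Qed.

(** The successor counts the vertex itself, whose diagonal entry is 0. *)
Definition row_size (i : nat) : nat :=
  (\sum_(0 <= q < n) matrix_cell (i * n + q)).+1.

Lemma card_cl (i : 'I_n) : E \subset pairs 'I_n -> #|cl E i| = row_size i.
Proof.
move=> sE; rewrite /row_size big_mkord.
have -> : cl E i = i |: [set j | adj E i j] by apply/setP=> j; rewrite !inE.
rewrite cardsU1 inE adj_irr // add1n; congr _.+1.
rewrite -sum1_card big_mkcond; apply: eq_bigr => j _.
by rewrite matrix_cellE inE; case: adj.
Qed.

Lemma prof_rows s : E \subset pairs 'I_n ->
  prof E s = \sum_(0 <= i < n) (row_size i == s).
Proof.
by move=> sE; rewrite profE big_mkord; apply: eq_bigr => i _; rewrite card_cl.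
Qed.

End Correctness.

(** * Program logic with running times *)

Fixpoint loop_free (c : cmd) : bool :=
  match c with
  | Seq c1 c2 => loop_free c1 && loop_free c2
  | If _ c1 c2 => loop_free c1 && loop_free c2
  | While _ _ => false
  | _ => true
  end.

(* Meaningful for loop-free programs only. *)
Fixpoint den (c : cmd) (s : state) : state :=
  match c with
  | Skip => s
  | Const r v => set_reg s r v
  | Add r a b => set_reg s r (regs s a + regs s b)
  | Defs.Sub r a b => set_reg s r (regs s a - regs s b)
  | Read r a => set_reg s r (cells s (regs s a))
  | Write a b => set_cell s (regs s a) (regs s b)
  | Seq c1 c2 => den c2 (den c1 s)
  | If a c1 c2 => if regs s a == 0 then den c2 s else den c1 s
  | While _ _ => s
  end.

(** For loop-free programs an upper bound on the time; adding the two branches of a conditional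
    avoids maxima. *)
Fixpoint len (c : cmd) : nat :=
  match c with
  | Seq c1 c2 => len c1 + len c2
  | If _ c1 c2 => (len c1 + len c2).+1
  | _ => 1
  end.

Fixpoint writes (c : cmd) : seq nat :=
  match c with
  | Const r _ | Add r _ _ | Defs.Sub r _ _ | Read r _ => [:: r]
  | Seq c1 c2 | If _ c1 c2 => writes c1 ++ writes c2
  | While _ c => writes c
  | _ => [::]
  end.

Definition unchanged (c : cmd) (s s' : state) : Prop :=
  forall r, r \notin writes c -> regs s' r = regs s r.

Lemma exec_loop_free c s : loop_free c ->
  exists2 t, t <= len c & exec c s t (den c s).
Proof.
elim: c s => //=.
- by move=> s _; exists 1 => //; constructor.
- by move=> r v s _; exists 1 => //; constructor.
- by move=> r a b s _; exists 1 => //; constructor.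
- by move=> r a b s _; exists 1 => //; constructor.
- by move=> r a s _; exists 1 => //; constructor.
- by move=> a b s _; exists 1 => //; constructor.
- move=> c1 IH1 c2 IH2 s /andP[/(IH1 s)[t1 l1 e1] /(IH2 (den c1 s))[t2 l2 e2]].
  by exists (t1 + t2); [exact: leq_add | apply: exec_seq e1 e2].
move=> a c1 IH1 c2 IH2 s /andP[/(IH1 s)[t1 l1 e1] /(IH2 s)[t2 l2 e2]].
case: eqP => sa.
  by exists t2.+1; [lia | apply: exec_if_false].
by exists t1.+1; [lia | apply: exec_if_true].
Qed.

Lemma exec_unchanged c s t s' : exec c s t s' -> unchanged c s s'.
Proof.
rewrite /unchanged; elim=> //=.
- by move=> r v u q; rewrite inE /upd => /negbTE->.
- by move=> r a b u q; rewrite inE /upd => /negbTE->.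
- by move=> r a b u q; rewrite inE /upd => /negbTE->.
- by move=> r a u q; rewrite inE /upd => /negbTE->.
- move=> c1 c2 s0 t1 s1 t2 s2 _ IH1 _ IH2 r; rewrite mem_cat negb_or.
  by case/andP=> r1 r2; rewrite IH2 // IH1.
- move=> a c1 c2 s0 t0 s1 _ _ IH r; rewrite mem_cat negb_or => /andP[r1 _].
  exact: IH.
- move=> a c1 c2 s0 t0 s1 _ _ IH r; rewrite mem_cat negb_or => /andP[_ r2].
  exact: IH.
- by move=> a c0 s0 t1 s1 t2 s2 _ _ IH1 _ IH2 r rc; rewrite IH2 // IH1.
Qed.

(** Total correctness with a time bound. The built-in frame condition lets a specification mention
    only what changes; membership in [writes c] is decided by computation. *)
Definition wp (c : cmd) (T : nat) (s : state) (Q : state -> Prop) : Prop :=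
  exists t s', [/\ exec c s t s', t <= T, unchanged c s s' & Q s'].

Lemma wp_intro c T s (Q : state -> Prop) t s' :
  exec c s t s' -> t <= T -> Q s' -> wp c T s Q.
Proof. by move=> e lt q; exists t, s'; split=> //; apply: exec_unchanged e. Qed.

Lemma wp_weaken c T T' s (Q Q' : state -> Prop) : wp c T s Q -> T <= T' ->
  (forall s', unchanged c s s' -> Q s' -> Q' s') -> wp c T' s Q'.
Proof.
move=> [t [s' [e lt u q]]] TT' sub; apply: wp_intro e _ _; last exact: sub.
exact: leq_trans TT'.
Qed.

Lemma wp_den c s (Q : state -> Prop) :
  loop_free c -> Q (den c s) -> wp c (len c) s Q.
Proof. by move=> /(exec_loop_free s)[t lt e] q; apply: wp_intro e lt q. Qed.

Lemma wp_seq c1 c2 T1 T2 s Q1 Q : wp c1 T1 s Q1 ->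
  (forall s1, unchanged c1 s s1 -> Q1 s1 -> wp c2 T2 s1 Q) ->
  wp (Seq c1 c2) (T1 + T2) s Q.
Proof.
move=> [t1 [s1 [e1 l1 u1 q1]]] /(_ s1 u1 q1)[t2 [s2 [e2 l2 _ q]]].
by apply: wp_intro (exec_seq e1 e2) (leq_add l1 l2) q.
Qed.

Lemma wp_if a c1 c2 T1 T2 s Q :
  (regs s a <> 0 -> wp c1 T1 s Q) -> (regs s a = 0 -> wp c2 T2 s Q) ->
  wp (If a c1 c2) (T1 + T2).+1 s Q.
Proof.
move=> w1 w2; have [sa|sa] := eqVneq (regs s a) 0.
  have [t [s' [e lt _ q]]] := w2 sa.
  by apply: wp_intro (exec_if_false _ sa e) _ q; lia.
have [t [s' [e lt _ q]]] := w1 (elimN eqP sa).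
by apply: wp_intro (exec_if_true _ (elimN eqP sa) e) _ q; lia.
Qed.

(** [I j] describes the state with [j] rounds to go. Each round pays for one test, and the failing
    test adds the final step. *)
Lemma wp_for i c T m (I : nat -> state -> Prop) s : regs s i = m -> I m s ->
  (forall j s', j < m -> I j.+1 s' -> regs s' i = j.+1 -> unchanged c s s' ->
     wp c T s' (fun s'' => I j s'' /\ regs s'' i = j)) ->
  wp (While i c) (m * T.+1).+1 s (fun s' => I 0 s').
Proof.
move=> si Im step.
suff main j s' : j <= m -> I j s' -> regs s' i = j -> unchanged c s s' ->
    wp (While i c) (j * T.+1).+1 s' (fun s'' => I 0 s'').
  exact: main.
elim: j s' => [|j IH] s' jm Ij ij us.
  by apply: wp_intro (exec_while_false _ ij) _ Ij.
have [t [s1 [e lt u [I1 i1]]]] := step _ _ jm Ij ij us.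
have [|t2 [s2 [e2 l2 _ q]]] := IH _ (ltnW jm) I1 i1.
  by move=> r rc; rewrite u // us.
apply: wp_intro (exec_while_true _ e e2) _ q; first by rewrite ij.
by rewrite mulSn; lia.
Qed.

(** * The program *)

Local Notation "c1 ;; c2" := (Seq c1 c2) (at level 61, right associativity).

(* [rz] is never written, hence stays 0, and [rB] is the base address [n * n] of
   the profile, placed right after the adjacency matrix. *)
Local Notation rn := 0 (only parsing).
Local Notation rk := 1 (only parsing).
Local Notation reta := 2 (only parsing).
Local Notation rone := 3 (only parsing).
Local Notation rM := 4 (only parsing).
Local Notation rN := 5 (only parsing).
Local Notation rw := 6 (only parsing).
Local Notation rb := 7 (only parsing).
Local Notation rx := 8 (only parsing).
Local Notation ry := 9 (only parsing).
Local Notation rp := 10 (only parsing).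
Local Notation rB := 11 (only parsing).
Local Notation rans := 12 (only parsing).
Local Notation ri := 13 (only parsing).
Local Notation rj := 14 (only parsing).
Local Notation rt := 15 (only parsing).
Local Notation ra := 16 (only parsing).
Local Notation ru := 17 (only parsing).
Local Notation rv := 18 (only parsing).
Local Notation rz := 19 (only parsing).
Local Notation rr := 20 (only parsing).
Local Notation rd := 21 (only parsing).
Local Notation rc := 22 (only parsing).
Local Notation re := 23 (only parsing).
Local Notation rmn := 24 (only parsing).
Local Notation rmx := 25 (only parsing).
Local Notation rs := 26 (only parsing).

Definition clear_cells : cmd :=
  Add ri rn rone ;;
  While ri (Defs.Sub ri ri rone ;; Add ra rB ri ;; Write ra rz).

Definition read_row : cmd :=
  While rj (Read rt rr ;; Add rd rd rt ;; Add rr rr rone ;; Defs.Sub rj rj rone).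

(** The pointer [rr] is not reset between rows: the matrix is stored row by row, so no product
    [i * n] is needed. [rd] starts at 1 for the vertex itself. *)
Definition load_profile : cmd :=
  (Add ri rn rz ;; Const rr 0) ;;
  While ri ((Const rd 1 ;; Add rj rn rz) ;; read_row ;;
    (Add ra rB rd ;; Read rt ra ;; Add rt rt rone ;; Write ra rt ;;
     Defs.Sub ri ri rone)).

(** Under truncated subtraction [w + 1 - M] is nonzero exactly when [M <= w]; [apply_digit] tests
    the budget in the same way. *)
Definition next_bit (r : nat) : cmd :=
  Add rw rw rw ;; Add rt rw rone ;; Defs.Sub rt rt rM ;;
  If rt (Defs.Sub rw rw rM ;; Const r 1) (Const r 0).

Definition add_size (r : nat) : cmd :=
  Add ra rB r ;; Read rc ra ;; Add rc rc r ;; Write ra rc.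

Definition split_cmd : cmd :=
  Add rt rx ry ;; Add ra rB rt ;; Read rc ra ;;
  If rc (Defs.Sub rc rc rt ;; Write ra rc ;; add_size rx ;; add_size ry ;; Defs.Sub rb rb rp)
        Skip.

(** The first cluster is taken out before the second is looked up, as in [can_merge]; if none is
    found, [Write ra rc] puts the old count back. *)
Definition merge_cmd : cmd :=
  Add ra rB rx ;; Read rc ra ;;
  If rc (Defs.Sub rd rc rx ;; Write ra rd ;; Add rs rB ry ;; Read re rs ;;
         If re (Defs.Sub re re ry ;; Write rs re ;; Add rt rx ry ;; add_size rt ;;
                Defs.Sub rb rb rp)
               (Write ra rc))
        Skip.

(** [rp] carries the product of the two sizes: when one size grows by 1, the product grows by the
    other. *)
Definition apply_digit : cmd :=
  If ru
    (If rv (Add ry ry rone ;; Add rp rp rx) (Add rx rx rone ;; Add rp rp ry))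
    ((Add rt rb rone ;; Defs.Sub rt rt rp ;;
      If rt (If rv merge_cmd split_cmd) Skip) ;;
     Const rx 1 ;; Const ry 1 ;; Const rp 1).

Definition run_digits : cmd :=
  (Add rw rN rz ;; Add rb rk rz ;; Const rx 1 ;; Const ry 1 ;; Const rp 1 ;;
   Add ri rk rz) ;;
  While ri ((next_bit ru ;; next_bit rv) ;; (apply_digit ;; Defs.Sub ri ri rone)).

(** Comparing the extreme occurring sizes suffices; [rmn = 0] means that none has been met. [rans]
    is only ever raised, so it collects a disjunction over all rounds. *)
Definition check_balanced : cmd :=
  (Const rmn 0 ;; Const rmx 0 ;; Const rs 0 ;; Add ri rn rz) ;;
  (While ri (Add rs rs rone ;; Add ra rB rs ;; Read rt ra ;;
     If rt (Add rmx rs rz ;; If rmn Skip (Add rmn rs rz)) Skip ;;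
     Defs.Sub ri ri rone)) ;;
  (Defs.Sub rt rmx rmn ;; Defs.Sub rt rt reta ;; If rt Skip (Const rans 1)).

Definition square : cmd :=
  (Const rone 1 ;; Add ri rn rz) ;; While ri (Add rB rB rn ;; Defs.Sub ri ri rone).

Definition power : cmd :=
  (Const rM 1 ;; Add ri rk rz) ;;
  While ri (Add rM rM rM ;; Add rM rM rM ;; Defs.Sub ri ri rone).

Definition search : cmd :=
  Add rN rM rz ;;
  While rN (Defs.Sub rN rN rone ;;
    clear_cells ;; load_profile ;; run_digits ;; check_balanced).

Definition program : cmd := square ;; power ;; search ;; Add rn rans rz.

(** * Verification of the subprograms *)

Lemma wp_next_bit r s M w : regs s rM = M -> regs s rone = 1 -> regs s rw = w ->
  r != rw -> r != rt ->
  wp (next_bit r) (len (next_bit r)) s (fun s' => [/\ cells s' = cells s,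
    regs s' rw = shift M w & regs s' r = top_bit M w]).
Proof.
move=> eM e1 ew nw nt; apply: wp_den => //=; rewrite /upd /= eM e1 ew.
rewrite /shift /top_bit; case: eqP => h /=; rewrite /upd /= ?eqxx.
  have -> : (M <= w + w) = false by lia.
  by rewrite eq_sym (negbTE nw) subn0.
have -> : M <= w + w by lia.
by rewrite eq_sym (negbTE nw) mul1n.
Qed.

(** The matrix below [B] belongs to the assertion because every round reads it anew. *)
Definition holds (B : nat) (A f : nat -> nat) (s : state) : Prop :=
  (forall a, cells s (B + a) = f a) /\ (forall a, a < B -> cells s a = A a).

Lemma holds_upd B A f s s' a v : holds B A f s ->
  cells s' = upd (cells s) (B + a) v -> holds B A (upd f a v) s'.
Proof.
move=> [hi lo] e; rewrite /holds e; split=> a'; first by rewrite /upd eqn_add2l hi.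
by move=> aB; rewrite /upd ifN ?lo //; lia.
Qed.

Lemma holds_cells B A f s s' : holds B A f s -> cells s' = cells s -> holds B A f s'.
Proof. by rewrite /holds => h ->. Qed.

Lemma wp_add_size r B A f s : holds B A f s -> regs s rB = B ->
  r != ra -> r != rc ->
  wp (add_size r) (len (add_size r)) s (holds B A (incr f (regs s r) (regs s r))).
Proof.
move=> hf hB na nc; apply: wp_den => //; apply: (holds_upd hf) => /=.
rewrite /upd /=.
by rewrite (negbTE na) (negbTE nc) hB hf.1.
Qed.

Lemma wp_split B A f b x y s : holds B A f s -> regs s rB = B ->
  regs s rx = x -> regs s ry = y -> regs s rp = x * y -> regs s rb = b ->
  wp split_cmd (len split_cmd) s (fun s' => if can_split f x y
    then regs s' rb = b - x * y /\ holds B A (split_prof f x y) s'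
    else regs s' rb = b /\ holds B A f s').
Proof.
move=> hf hB hx hy hp hb.
apply: (@wp_seq _ _ 1 _ _ (fun s1 => regs s1 rt = x + y /\ holds B A f s1)).
  by apply: wp_den => //=; rewrite /upd /= hx hy.
move=> s1 u1 [t1 hf1].
apply: (@wp_seq _ _ 1 _ _ (fun s2 => regs s2 ra = B + (x + y) /\ holds B A f s2)).
  by apply: wp_den => //=; rewrite /upd /= u1 // hB t1.
move=> s2 u2 [a2 hf2].
apply: (@wp_seq _ _ 1 _ _ (fun s3 => regs s3 rc = f (x + y) /\ holds B A f s3)).
  by apply: wp_den => //=; rewrite /upd /= a2 hf2.1.
move=> s3 u3 [c3 hf3].
apply: wp_if; rewrite c3 /can_split => h3; last first.
  by rewrite h3 /=; apply: wp_den => //=; rewrite u3 // u2 // u1.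
rewrite (introN eqP h3).
have B3 : regs s3 rB = B by rewrite u3 // u2 // u1.
apply: (@wp_seq _ _ 1 _ _ (fun s4 => regs s4 rc = f (x + y) - (x + y) /\ holds B A f s4)).
  by apply: wp_den => //=; rewrite /upd /= c3 u3 // u2 // t1.
move=> s4 u4 [c4 hf4].
apply: (@wp_seq _ _ 1 _ _ (holds B A (decr f (x + y) (x + y)))).
  apply: wp_den => //=; apply: (holds_upd hf4) => /=.
  by rewrite c4 u4 // u3 // a2.
move=> s5 u5 hf5.
apply: (wp_seq (wp_add_size hf5 _ _ _)) => //.
  by rewrite u5 // u4.
move=> s6 u6; rewrite u5 // u4 // u3 // u2 // u1 // hx => hf6.
apply: (wp_seq (wp_add_size hf6 _ _ _)) => //.
  by rewrite u6 // u5 // u4.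
move=> s7 u7; rewrite u6 // u5 // u4 // u3 // u2 // u1 // hy => hf7.
apply: wp_den => //=; rewrite /upd /=.
by rewrite !u7 // !u6 // !u5 // !u4 // !u3 // !u2 // !u1 // hb hp.
Qed.

Lemma wp_merge B A f b x y s : holds B A f s -> regs s rB = B ->
  regs s rx = x -> regs s ry = y -> regs s rp = x * y -> regs s rb = b ->
  wp merge_cmd (len merge_cmd) s (fun s' => if can_merge f x y
    then regs s' rb = b - x * y /\ holds B A (merge_prof f x y) s'
    else regs s' rb = b /\ holds B A f s').
Proof.
move=> hf hB hx hy hp hb.
apply: (@wp_seq _ _ 1 _ _ (fun s1 => regs s1 ra = B + x /\ holds B A f s1)).
  by apply: wp_den => //=; rewrite /upd /= hx hB.
move=> s1 u1 [a1 hf1].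
apply: (@wp_seq _ _ 1 _ _ (fun s2 => regs s2 rc = f x /\ holds B A f s2)).
  by apply: wp_den => //=; rewrite /upd /= a1 hf1.1.
move=> s2 u2 [c2 hf2].
apply: wp_if; rewrite c2 /can_merge => h2; last first.
  by rewrite h2 /=; apply: wp_den => //=; rewrite u2 // u1.
rewrite (introN eqP h2) /=.
apply: (@wp_seq _ _ 1 _ _ (fun s3 => regs s3 rd = f x - x /\ holds B A f s3)).
  by apply: wp_den => //=; rewrite /upd /= c2 u2 // u1 // hx.
move=> s3 u3 [d3 hf3].
apply: (@wp_seq _ _ 1 _ _ (holds B A (decr f x x))).
  apply: wp_den => //=; apply: (holds_upd hf3) => /=.
  by rewrite d3 u3 // u2 // a1.
move=> s4 u4 hf4.
apply: (@wp_seq _ _ 1 _ _ (fun s5 => regs s5 rs = B + y /\ holds B A (decr f x x) s5)).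
  by apply: wp_den => //=; rewrite /upd /= !u4 // !u3 // !u2 // !u1 // hB hy.
move=> s5 u5 [a5 hf5].
apply: (@wp_seq _ _ 1 _ _
  (fun s6 => regs s6 re = decr f x x y /\ holds B A (decr f x x) s6)).
  by apply: wp_den => //=; rewrite /upd /= a5 hf5.1.
move=> s6 u6 [e6 hf6].
apply: wp_if; rewrite e6 => h6; last first.
  rewrite h6 /=; apply: wp_den => //=; split.
    by rewrite u6 // u5 // u4 // u3 // u2 // u1.
  have := @holds_upd B A _ s6 (den (Write ra rc) s6) x (f x) hf6.
  rewrite /= !u6 // !u5 // !u4 // !u3 // c2 !u2 // a1 => /(_ erefl)[hi lo].
  split=> // a; rewrite hi /decr /upd.
  by case: eqP => [->|].
rewrite (introN eqP h6).
apply: (@wp_seq _ _ 1 _ _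
  (fun s7 => regs s7 re = decr f x x y - y /\ holds B A (decr f x x) s7)).
  apply: wp_den => //=; rewrite /upd /= e6.
  by rewrite u6 // u5 // u4 // u3 // u2 // u1 // hy.
move=> s7 u7 [e7 hf7].
apply: (@wp_seq _ _ 1 _ _ (holds B A (decr (decr f x x) y y))).
  apply: wp_den => //=; apply: (holds_upd hf7) => /=.
  by rewrite e7 u7 // u6 // a5.
move=> s8 u8 hf8.
have all8 r : r \notin [:: ra; rc; rd; rs; re] -> regs s8 r = regs s r.
  rewrite !inE !negb_or => /and5P[? ? ? ? ?].
  by rewrite u8 // u7 ?inE // u6 ?inE // u5 ?inE // u4 // u3 ?inE // u2 ?inE // u1 ?inE.
apply: (@wp_seq _ _ 1 _ _
  (fun s9 => regs s9 rt = x + y /\ holds B A (decr (decr f x x) y y) s9)).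
  by apply: wp_den => //=; rewrite /upd /= !all8 // hx hy.
move=> s9 u9 [t9 hf9].
apply: (wp_seq (wp_add_size hf9 _ _ _)) => //.
  by rewrite u9 // all8.
move=> s10 u10; rewrite t9 => hf10.
apply: wp_den => //=; rewrite /upd /=.
by rewrite !u10 // !u9 // !all8 // hb hp.
Qed.

Definition matches (B : nat) (A : nat -> nat) (c : conf) (s : state) : Prop :=
  [/\ regs s rb = bud c, regs s rx = cx c, regs s ry = cy c,
      regs s rp = cx c * cy c & holds B A (cnt c) s].

Lemma wp_apply_digit B A c (u v : bool) s : matches B A c s ->
  regs s ru = u -> regs s rv = v -> regs s rone = 1 -> regs s rB = B ->
  wp apply_digit (len apply_digit) s (matches B A (dstep c (u, v))).
Proof.
case: c => f b x y; rewrite {1}/matches /= => -[hb hx hy hp hf] hu hv h1 hB.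
apply: wp_if; rewrite hu; case: u {hu} => //= _.
  apply: wp_if; rewrite hv; case: v {hv} => //= _; apply: wp_den => //.
    by split; rewrite //= /upd /= ?hb ?hx ?hy ?hp ?h1 ?mulnS; lia.
  by split; rewrite //= /upd /= ?hb ?hx ?hy ?hp ?h1 ?mulSn; lia.
(* Profile and budget after the attempted move; the reset of the sizes is common to all outcomes. *)
pose c1 := if v then
    if (x * y <= b) && can_merge f x y then (merge_prof f x y, b - x * y) else (f, b)
  else if (x * y <= b) && can_split f x y then (split_prof f x y, b - x * y) else (f, b).
apply: (@wp_seq _ _ _ _ _ (fun s1 => regs s1 rb = c1.2 /\ holds B A c1.1 s1)); last first.
  move=> s1 u1 [hb1 hf1]; apply: wp_den => //.
  by rewrite /c1 in hb1 hf1; case: v hv c1 hb1 hf1 => _ _; case: ifP.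
apply: (@wp_seq _ _ 1 _ _ (fun s1 => regs s1 rt = b.+1 /\ cells s1 = cells s)).
  by apply: wp_den => //=; rewrite /upd /= hb h1 addn1.
move=> s1 u1 [t1 e1].
apply: (@wp_seq _ _ 1 _ _ (fun s2 => regs s2 rt = b.+1 - x * y /\ cells s2 = cells s)).
  by apply: wp_den => //=; rewrite /upd /= t1 u1 // hp.
move=> s2 u2 [t2 e2]; have hf2 := holds_cells hf e2.
apply: wp_if; rewrite t2 => ht; last first.
  apply: wp_den => //=; rewrite /c1.
  have -> : (x * y <= b) = false by lia.
  by case: (v); rewrite /= u2 // u1.
have xyb : x * y <= b by lia.
rewrite /c1 xyb /=; apply: wp_if; rewrite u2 // u1 // hv; case: v {hv c1} => //= _.
  have [|||||] := @wp_merge B A f b x y s2 hf2; rewrite ?u2 ?u1 //.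
  move=> t [s' [e lt _ q]]; apply: wp_intro e lt _.
  by move: q; case: ifP.
have [|||||] := @wp_split B A f b x y s2 hf2; rewrite ?u2 ?u1 //.
move=> t [s' [e lt _ q]]; apply: wp_intro e lt _.
by move: q; case: ifP.
Qed.

Lemma wp_run_digits B A f M N k s : holds B A f s ->
  regs s rB = B -> regs s rM = M -> regs s rN = N -> regs s rk = k ->
  regs s rone = 1 -> regs s rz = 0 ->
  wp run_digits (6 + (k * 75).+1) s
    (holds B A (cnt (interp M k N (Conf f k 1 1)))).
Proof.
move=> hf hB hM hN hk h1 hz.
(* The digits still to come lead from the current configuration to the final one; nothing need be
   said about those already read. *)
pose I j s' := exists w c, [/\ interp M k N (Conf f k 1 1) = interp M j w c,
  regs s' rw = w & matches B A c s'].
apply: (@wp_seq _ _ 6 _ _ (fun s1 => I k s1 /\ regs s1 ri = k)).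
  apply: wp_den => //; split; last by rewrite /= /upd /= hk hz addn0.
  exists N, (Conf f k 1 1); split=> //; first by rewrite /= /upd /= hN hz addn0.
  by split; rewrite //= /upd /= hk hz addn0.
move=> s1 u1 [I1 i1].
apply: wp_weaken (@wp_for _ _ 74 k I _ i1 I1 _) _ _ => //; last first.
  by move=> s' _ [w [c [-> _ [_ _ _ _ ?]]]].
move=> j s2 jk [w [c [ew rw2 m2]]] i2 u2.
have fixed r : r \in [:: rB; rM; rone] -> regs s2 r = regs s r.
  by rewrite !inE => /or3P[] /eqP->; rewrite u2 // u1.
(* Two bits at 7 steps each; 60 generously covers the digit and the decrement. *)
rewrite -[74]/(14 + 60).
pose Q3 s3 := [/\ regs s3 ru = top_bit M w, regs s3 rv = top_bit M (shift M w),
  regs s3 rw = shift M (shift M w) & cells s3 = cells s2].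
apply: (@wp_seq _ _ 14 _ _ Q3).
  have M2 : regs s2 rM = M by rewrite fixed.
  have one2 : regs s2 rone = 1 by rewrite fixed.
  apply: (@wp_seq _ _ 7 7 _ _ _ (@wp_next_bit ru _ _ _ M2 one2 rw2 isT isT)) => s3 u3 [e3 w3 t3].
  rewrite -(u3 rM isT) in M2; rewrite -(u3 rone isT) in one2.
  apply: wp_weaken (@wp_next_bit rv _ _ _ M2 one2 w3 isT isT) _ _ => // s4 u4 [e4 w4 t4].
  by split=> //; [rewrite u4 | rewrite e4].
move=> s3 u3 [hu hv hw e3].
have m3 : matches B A c s3.
  case: m2 => mb mx my mp mf; split; rewrite ?u3 //.
  exact: holds_cells mf e3.
apply: (@wp_seq _ _ 59 1 _ _ _ (wp_weaken (wp_apply_digit m3 hu hv _ _) _ (fun _ _ q => q))).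
- by rewrite u3 // fixed.
- by rewrite u3 // fixed.
- by [].
move=> s4 u4 m4; apply: wp_den => //; split.
  exists (shift M (shift M w)), (dstep c (top_bit M w, top_bit M (shift M w))).
  by split=> //=; rewrite /upd /= u4.
by rewrite /= /upd /= u4 // u3 // i2 u4 // u3 // fixed // h1; lia.
Qed.

(** With the counts beyond size [n] already 0, resetting [n + 1] cells erases the whole profile of
    the previous round. *)
Lemma wp_clear_cells n A f s : holds (n * n) A f s -> (forall a, n < a -> f a = 0) ->
  regs s rn = n -> regs s rB = n * n -> regs s rone = 1 -> regs s rz = 0 ->
  wp clear_cells (1 + (n.+1 * 4).+1) s (holds (n * n) A (fun=> 0)).
Proof.
move=> hf f0 hn hB h1 hz.
pose I j s' := holds (n * n) A (fun a => if a < j then f a else 0) s'.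
apply: (@wp_seq _ _ 1 _ _ (fun s1 => I n.+1 s1 /\ regs s1 ri = n.+1)).
  apply: wp_den => //; split; last by rewrite /= /upd /= hn h1 addn1.
  case: hf => hi lo; split=> // a; rewrite /= hi.
  by case: ltnP => // na; rewrite f0.
move=> s1 u1 [I1 i1].
apply: wp_weaken (@wp_for _ _ 3 n.+1 I _ i1 I1 _) _ _ => // j s2 jn I2 i2 u2.
apply: wp_den => //=; split; last by rewrite /upd /= i2 u2 // u1 // h1 subn1.
have := @holds_upd _ _ _ s2 (set_cell s2 (n * n + j) 0) j 0 I2 erefl.
case=> hi lo; split=> /= a.
  rewrite /upd /= i2 !u2 // !u1 // hB h1 hz subn1 /=.
  move: (hi a) => /=; rewrite /upd => ->.
  by rewrite ltnS; case: ltngtP.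
by rewrite /upd /= i2 !u2 // !u1 // hB h1 hz subn1 /=; exact: lo.
Qed.

Lemma wp_load_profile n A s : holds (n * n) A (fun=> 0) s ->
  regs s rn = n -> regs s rB = n * n -> regs s rone = 1 -> regs s rz = 0 ->
  wp load_profile (2 + (n * (2 + ((n * 5).+1 + 5)).+1).+1) s
    (holds (n * n) A (fun a => \sum_(0 <= i < n)
       ((\sum_(0 <= q < n) A (i * n + q)).+1 == a))).
Proof.
move=> hf hn hB h1 hz.
pose d i := (\sum_(0 <= q < n) A (i * n + q)).+1.
pose I j s' := regs s' rr = (n - j) * n /\
  holds (n * n) A (fun a => \sum_(0 <= i < n - j) (d i == a)) s'.
apply: (@wp_seq _ _ 2 _ _ (fun s1 => I n s1 /\ regs s1 ri = n)).
  apply: wp_den => //; split; last by rewrite /= /upd /= hn hz addn0.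
  split; first by rewrite /= subnn.
  by case: hf => hi lo; split=> // a; rewrite subnn big_geq //= hi.
move=> s1 u1 [I1 i1].
apply: wp_weaken (@wp_for _ _ _ n I _ i1 I1 _) (leqnn _) _ => [j s2 jn [r2 h2] i2 u2|].
  have fixed r : r \in [:: rB; rn; rone; rz] -> regs s2 r = regs s r.
    by rewrite !inE => /or4P[] /eqP->; rewrite u2 // u1.
  set i := n - j.+1 in r2 h2.
  pose J l s' := [/\ regs s' rr = i * n + (n - l),
    regs s' rd = (\sum_(0 <= q < n - l) A (i * n + q)).+1 & cells s' = cells s2].
  apply: (@wp_seq _ _ 2 _ _ (fun s3 => J n s3 /\ regs s3 rj = n)).
    apply: wp_den => //; split; last by rewrite /= /upd /= !fixed // hn hz addn0.
    by split; rewrite //= /upd /= ?r2 ?subnn ?addn0 ?big_geq.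
  move=> s3 u3 [J3 j3].
  have i_n : i < n by rewrite /i; lia.
  apply: (@wp_seq _ _ _ _ _ (J 0)).
    apply: wp_weaken (@wp_for _ _ 4 n J _ j3 J3 _) _ _ => // l s4 ln [r4 d4 e4] j4 u4.
    apply: wp_den => //; split; last first.
      by rewrite /= /upd /= j4 !u4 // !u3 // fixed // h1 subn1.
    rewrite /J -(subnSK ln); set q := n - l.+1 in r4 d4 *.
    split=> //=; rewrite /upd /=.
      by rewrite r4 !u4 // !u3 // fixed // h1; lia.
    rewrite d4 r4 e4 h2.2; last by rewrite /q; nia.
    by rewrite big_nat_recr.
  move=> s4 u4 [r4 d4 e4]; rewrite subn0 -/(d i) in d4; rewrite subn0 in r4.
  apply: wp_den => //; split; last first.
    by rewrite /= /upd /= !u4 // !u3 // i2 fixed // h1 subn1.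
  rewrite /I -(subnSK jn) -/i; split; first by rewrite /= /upd /= r4; lia.
  have [hi lo] := @holds_upd _ _ _ s4 (set_cell s4 (n * n + d i) ((cells s4 (n * n + d i)).+1))
    (d i) _ (holds_cells h2 e4) erefl.
  split=> /= a; rewrite /upd /= d4 !u4 // !u3 // !fixed // hB h1 addn1.
    move: (hi a) => /=; rewrite /upd => ->.
    rewrite big_nat_recr //= e4 h2.1.
    by rewrite [d i == a]eq_sym; case: eqP => [->|_]; rewrite ?addn1 ?addn0.
  exact: lo.
by move=> s' _ [_]; rewrite subn0.
Qed.

Definition scanned (f : nat -> nat) (m mn mx : nat) : Prop :=
  (forall q, 1 <= q <= m -> f q <> 0 -> mn <= q <= mx) /\
  if mn == 0 then mx = 0 /\ (forall q, 1 <= q <= m -> f q = 0)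
  else [/\ 1 <= mn <= m, 1 <= mx <= m, f mn <> 0 & f mx <> 0].

Lemma scanned_good n eta f mn mx : scanned f n mn mx ->
  good n eta f = (mx - mn - eta == 0).
Proof.
move=> [range ends]; apply/allP/idP => [g|/eqP e s].
  move: ends; case: eqP => [-> [-> _]|_ [mnr mxr fmn fmx]] //.
  have /g/allP/(_ mn) : mx \in iota 1 n by rewrite mem_iota; lia.
  rewrite mem_iota (introN eqP fmn) (introN eqP fmx) /= => h.
  by have := h _; lia.
rewrite mem_iota => sn; apply/allP=> s'; rewrite mem_iota => sn'.
apply/implyP=> /eqP/range r; apply/implyP=> /eqP/range r'.
by have := r _; have := r' _; lia.
Qed.

Lemma scanned_step f m mn mx : scanned f m mn mx ->
  if f m.+1 == 0 then scanned f m.+1 mn mx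
  else scanned f m.+1 (if mn == 0 then m.+1 else mn) m.+1.
Proof.
move=> [range ends].
case: eqP => fm.
  split=> [q qm fq|].
    by apply: range => //; case: (eqVneq q m.+1) => [e|]; [rewrite e in fq | lia].
  move: ends; case: eqP => [_ [-> z]|_ [h1 h2 h3 h4]].
    split=> // q qm; case: (eqVneq q m.+1) => [-> //|ne]; apply: z; lia.
  by split=> //; lia.
split=> [q qm fq|].
  move: ends; case: eqP => [_ [_ z]|_ [h1 h2 h3 h4]].
    case: (eqVneq q m.+1) => [-> |ne]; first by lia.
    by case: fq; apply: z; lia.
  case: (eqVneq q m.+1) => [e|ne]; first by lia.
  by have := range q _ fq; lia.
move: ends; case: (eqVneq mn 0) => [e _|ne [h1 h2 h3 h4]] /=.
  by split=> //; lia.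
by rewrite (negbTE ne); split=> //; lia.
Qed.

Lemma wp_check_balanced n eta B A f (ans : bool) s : holds B A f s ->
  regs s rn = n -> regs s rB = B -> regs s rone = 1 -> regs s rz = 0 ->
  regs s reta = eta -> regs s rans = ans ->
  wp check_balanced (4 + ((n * 11).+1 + 5)) s (fun s' =>
    holds B A f s' /\ regs s' rans = ans || good n eta f).
Proof.
move=> hf hn hB h1 hz he ha.
pose I j s' := [/\ holds B A f s', regs s' rs = n - j &
  scanned f (n - j) (regs s' rmn) (regs s' rmx)].
apply: (@wp_seq _ _ 4 _ _ (fun s1 => I n s1 /\ regs s1 ri = n)).
  apply: wp_den => //; split; last by rewrite /= /upd /= hn hz addn0.
  rewrite /I subnn; split=> //; split=> /= [q|]; first by lia.
  by split=> // q; lia.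
move=> s1 u1 [I1 i1].
apply: (@wp_seq _ _ (n * 11).+1 5 _ (I 0)).
  apply: wp_weaken (@wp_for _ _ 10 n I _ i1 I1 _) _ _ => // j s2 jn [h2 sz2 sc2] i2 u2.
  have fixed r : r \in [:: rB; rone; rz] -> regs s2 r = regs s r.
    by rewrite !inE => /or3P[] /eqP->; rewrite u2 // u1.
  rewrite /I -(subnSK jn); set m := n - j.+1 in sz2 sc2 *.
  apply: (@wp_seq _ _ 1 9 _ (fun s3 => regs s3 rs = m.+1 /\ holds B A f s3)).
    by apply: wp_den => //=; rewrite /upd /= sz2 fixed // h1 addn1.
  move=> s3 u3 [sz3 h3].
  apply: (@wp_seq _ _ 1 8 _ (fun s4 => regs s4 ra = B + m.+1 /\ holds B A f s4)).
    by apply: wp_den => //=; rewrite /upd /= sz3 u3 // fixed // hB.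
  move=> s4 u4 [a4 h4].
  apply: (@wp_seq _ _ 1 7 _ (fun s5 => regs s5 rt = f m.+1 /\ holds B A f s5)).
    by apply: wp_den => //=; rewrite /upd /= a4 h4.1.
  move=> s5 u5 [t5 h5].
  have keep r : r \notin [:: rs; ra; rt] -> regs s5 r = regs s2 r.
    by rewrite !inE !negb_or => /and3P[? ? ?]; rewrite u5 ?inE // u4 ?inE // u3 ?inE.
  have := scanned_step sc2; rewrite -(keep rmn) // -(keep rmx) // => sc5.
  have sz5 : regs s5 rs = m.+1 by rewrite u5 // u4.
  apply: (@wp_seq _ _ 6 1 _ (fun s6 => [/\ holds B A f s6, regs s6 rs = m.+1 &
      scanned f m.+1 (regs s6 rmn) (regs s6 rmx)])).
    apply: (@wp_if _ _ _ 4 1); rewrite t5 => ft; last first.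
      by apply: wp_den => //; rewrite ft eqxx in sc5.
    rewrite (introF eqP ft) in sc5.
    apply: (@wp_seq _ _ 1 3 _ (fun s6 => [/\ holds B A f s6, regs s6 rmx = m.+1 &
      regs s6 rz = 0])).
      by apply: wp_den => //; split=> //=; rewrite /upd /= (keep rz) // fixed // hz ?sz5 ?addn0.
    move=> s6 u6 [h6 mx6 z6].
    apply: (@wp_if _ _ _ 1 1); rewrite u6 // => mn6; apply: wp_den => //; split=> //=.
    - by rewrite u6.
    - by rewrite mx6 u6 //; rewrite (introF eqP mn6) in sc5.
    - by rewrite /upd /= u6.
    - by rewrite /upd /= mx6 z6 addn0 u6 // sz5; rewrite mn6 eqxx in sc5.
  move=> s6 u6 [h6 sz6 sc6]; apply: wp_den => //; split.
    by split; rewrite //= /upd /= ?sz6.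
  by rewrite /= /upd /= !u6 // !keep // i2 fixed // h1 subn1.
move=> s2 u2 [h2 _ sc2]; rewrite subn0 in sc2.
have fixed r : r \in [:: reta; rans] -> regs s2 r = regs s r.
  by rewrite !inE => /orP[] /eqP->; rewrite u2 // u1.
rewrite (scanned_good eta sc2).
apply: (@wp_seq _ _ 1 4 _ (fun s3 => regs s3 rt = regs s2 rmx - regs s2 rmn /\ holds B A f s3)).
  exact: wp_den.
move=> s3 u3 [t3 h3].
apply: (@wp_seq _ _ 1 3 _ (fun s4 => regs s4 rt = regs s2 rmx - regs s2 rmn - eta /\ holds B A f s4)).
  by apply: wp_den => //=; rewrite /upd /= t3 u3 // (fixed reta) // he.
move=> s4 u4 [t4 h4].
apply: (@wp_if _ _ _ 1 1); rewrite t4 => z; apply: wp_den => //; split=> //=.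
  by rewrite u4 // u3 // fixed // ha (introF eqP z) orbF.
by rewrite z eqxx orbT.
Qed.

Lemma wp_square n s : regs s rn = n -> regs s rz = 0 -> regs s rB = 0 ->
  wp square (2 + (n * 3).+1) s (fun s' =>
    [/\ cells s' = cells s, regs s' rone = 1 & regs s' rB = n * n]).
Proof.
move=> hn hz hB.
pose I j s' := [/\ cells s' = cells s, regs s' rone = 1 & regs s' rB = (n - j) * n].
apply: (@wp_seq _ _ 2 _ _ (fun s1 => I n s1 /\ regs s1 ri = n)).
  by apply: wp_den => //; rewrite /I subnn /= /upd /= hn hz addn0 hB.
move=> s1 u1 [I1 i1].
apply: wp_weaken (@wp_for _ _ 2 n I _ i1 I1 _) _ _ => [j s2 jn [e2 o2 B2] i2 u2||s' _] //.
  apply: wp_den => //; rewrite /I -(subnSK jn) /= /upd /= o2 B2 i2 subn1.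
  by rewrite u2 // u1 // hn mulSn addnC.
by rewrite /I subn0.
Qed.

Lemma wp_power k s : regs s rk = k -> regs s rz = 0 -> regs s rone = 1 ->
  wp power (2 + (k * 4).+1) s (fun s' =>
    cells s' = cells s /\ regs s' rM = 4 ^ k).
Proof.
move=> hk hz h1.
pose I j s' := cells s' = cells s /\ regs s' rM = 4 ^ (k - j).
apply: (@wp_seq _ _ 2 _ _ (fun s1 => I k s1 /\ regs s1 ri = k)).
  by apply: wp_den => //; rewrite /I subnn /= /upd /= hk hz addn0.
move=> s1 u1 [I1 i1].
apply: wp_weaken (@wp_for _ _ 3 k I _ i1 I1 _) _ _ => [j s2 jk [e2 M2] i2 u2||s' _] //.
  apply: wp_den => //; rewrite /I -(subnSK jk) /= /upd /= M2 i2 expnS.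
  by rewrite u2 // u1 // h1 subn1; split=> //; split=> //; lia.
by rewrite /I subn0.
Qed.

Lemma holds_ext B A f g s : f =1 g -> holds B A f s -> holds B A g s.
Proof. by move=> fg [hi lo]; split=> // a; rewrite hi fg. Qed.

Definition round_time (n k : nat) : nat :=
  1 + ((1 + (n.+1 * 4).+1) + ((2 + (n * (2 + ((n * 5).+1 + 5)).+1).+1) +
  ((6 + (k * 75).+1) + (4 + ((n * 11).+1 + 5))))).

Lemma unchanged_in l c s s' r : unchanged c s s' -> r \in l ->
  all [pred q | q \notin writes c] l -> regs s' r = regs s r.
Proof. by move=> u rl /allP/(_ r rl); exact: u. Qed.

Lemma wp_search n (E : {set {set 'I_n}}) k eta s f :
  E \subset pairs 'I_n -> cluster_graph E ->
  holds (n * n) (matrix_cell E) f s -> (forall a, n < a -> f a = 0) ->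
  regs s rn = n -> regs s rk = k -> regs s reta = eta -> regs s rone = 1 ->
  regs s rM = 4 ^ k -> regs s rB = n * n -> regs s rz = 0 -> regs s rans = 0 ->
  wp search (1 + (4 ^ k * (round_time n k).+1).+1) s (fun s' =>
    regs s' rans = balanced_cluster_editing E k eta).
Proof.
move=> sE cE hf f0 hn hk he h1 hM hB hz ha.
have gE := (cluster_graphP sE).1 cE.
rewrite (editing_interp _ _ sE cE).
pose result N := interp (4 ^ k) k N (Conf (prof E) k 1 1).
(* The counter descends, so the numbers tried so far are those from [j] on. Of the old profile only
   its vanishing beyond [n] matters, for the next clearing. *)
pose I j s' := regs s' rans = has (fun N => good n eta (cnt (result N))) (iota j (4 ^ k - j))
  /\ exists g, holds (n * n) (matrix_cell E) g s' /\ (forall a, n < a -> g a = 0).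
apply: (@wp_seq _ _ 1 _ _ (fun s1 => I (4 ^ k) s1 /\ regs s1 rN = 4 ^ k)).
  apply: wp_den => //; split; last by rewrite /= /upd /= hM hz addn0.
  by split; [rewrite subnn /= /upd /= ha | exists f].
move=> s1 u1 [I1 N1].
apply: wp_weaken (@wp_for _ _ _ (4 ^ k) I _ N1 I1 _) (leqnn _) _ => [j s2 jM [a2 [g [hg g0]]] N2 u2|].
  have fixed2 r : r \in [:: rn; rk; reta; rone; rM; rB; rz] -> regs s2 r = regs s r.
    by move=> rin; rewrite (unchanged_in u2 rin) // (unchanged_in u1 rin).
  apply: (@wp_seq _ _ 1 _ _ (fun s3 => regs s3 rN = j /\ holds (n * n) (matrix_cell E) g s3)).
    by apply: wp_den => //=; rewrite /upd /= N2 fixed2 // h1 subn1.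
  move=> s3 u3 [N3 h3].
  have fixed3 r : r \in [:: rn; rk; reta; rone; rM; rB; rz] -> regs s3 r = regs s r.
    by move=> rin; rewrite (unchanged_in u3 rin) // fixed2.
  apply: (wp_seq (wp_clear_cells h3 g0 _ _ _ _)); rewrite ?fixed3 //.
  move=> s4 u4 h4.
  have fixed4 r : r \in [:: rn; rk; reta; rone; rM; rB; rz] -> regs s4 r = regs s r.
    by move=> rin; rewrite (unchanged_in u4 rin) // fixed3.
  apply: (wp_seq (wp_load_profile h4 _ _ _ _)); rewrite ?fixed4 //.
  move=> s5 u5 /(@holds_ext _ _ _ (prof E)) h5.
  have {}h5 := h5 (fun a => esym (prof_rows a sE)).
  have fixed5 r : r \in [:: rn; rk; reta; rone; rM; rB; rz] -> regs s5 r = regs s r.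
    by move=> rin; rewrite (unchanged_in u5 rin) // fixed4.
  have N5 : regs s5 rN = j by rewrite u5 // u4.
  apply: (wp_seq (@wp_run_digits _ _ _ (4 ^ k) j k _ h5 _ _ N5 _ _ _)); rewrite ?fixed5 //.
  move=> s6 u6 h6.
  have fixed6 r : r \in [:: rn; rk; reta; rone; rM; rB; rz] -> regs s6 r = regs s r.
    by move=> rin; rewrite (unchanged_in u6 rin) // fixed5.
  have a6 : regs s6 rans = has (fun N => good n eta (cnt (result N))) (iota j.+1 (4 ^ k - j.+1)).
    by rewrite u6 // u5 // u4 // u3.
  apply: wp_weaken (@wp_check_balanced n eta _ _ _ _ _ h6 _ _ _ _ _ a6) _ _; rewrite ?fixed6 //.
  move=> s7 u7 [h7 a7].
  split; last by rewrite u7 // u6.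
  split; first by rewrite a7 -(subnSK jM) /= orbC.
  exists (cnt (result j)); split=> // a na.
  have : reaches E k (Conf (prof E) k 1 1).
    split=> //; exists E; split=> //=.
    by rewrite /symdiff setDv setU0 cards0.
  case/(interp_reaches (4 ^ k) k j)=> _ _ [F [_ fF _]].
  by rewrite fF prof_large.
by move=> s' _ [-> _]; rewrite subn0.
Qed.

(** * Sublinearity of the logarithm and the total time *)

Lemma square_le_exp q : q ^ 2 <= 2 * 2 ^ q.
Proof.
have [|q5] := ltnP q 5; first by do 5!case: q => [//|q].
elim: q q5 => // q IH; rewrite ltnS leq_eqVlt => /orP[/eqP<- //|q5].
by have := IH q5; rewrite !expnS !expn0; nia.
Qed.

Lemma sublinear_log C : sublinear (fun k => C + up_log 2 k.+1).
Proof.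
move=> eps eps0; pose m := Num.bound (eps^-1)%R.
have hm : (eps^-1 < m%:R)%R by apply: archi_boundP; rewrite invr_ge0 ltW.
have meps : (1 <= eps * m%:R)%R.
  by rewrite -ler_pdivrMl // mulr1 ltW.
exists (m * (4 * m + 2 * C + 3)).+1 => k hk.
suff le : m * (C + up_log 2 k.+1) <= k.
  apply: (@le_trans _ _ (eps * m%:R * (C + up_log 2 k.+1)%:R)%R).
    by rewrite ler_peMl.
  by rewrite -mulrA -natrM ler_wpM2l ?ler_nat // ltW.
have k1 : 1 < k.+1 by lia.
have := up_log_gtn (isT : 1 < 2) k1; rewrite ltnS.
have : 0 < up_log 2 k.+1 by rewrite up_log_gt0.
move: (up_log 2 k.+1) => [//|q] _ /= hq.
(* For small [q] the threshold on [k] suffices. Otherwise [C + 1 <= q] and [4 * m <= q] give [m * (C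
   + q + 1) <= 2 * m * q <= q ^ 2 / 2 <= 2 ^ q <= k]. *)
have [small|large] := ltnP q (4 * m + C + 1); first by nia.
have := square_le_exp q; rewrite expnS expn1 => sq.
by nia.
Qed.

(** The added terms pay for the setup, which can be charged to every round because [4 ^ k >= 1]. *)
Lemma round_time_bound n k :
  round_time n k + 3 * n + 4 * k + 11 <= 4 ^ 4 * (k.+1 * n.+1 ^ 2).
Proof. by rewrite /round_time !expnS expn0; nia. Qed.

Theorem mainTheorem10 :
  exists (p : cmd) (f : nat -> nat) (c : nat),
    sublinear f /\
    forall (n : nat) (E : {set {set 'I_n}}) (k eta : nat),
      E \subset pairs 'I_n -> cluster_graph E ->
      exists (t : nat) (s : state),
        exec p (input E k eta) t s /\
        t <= 4 ^ (k + f k) * n.+1 ^ c /\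
        output s = (if balanced_cluster_editing E k eta then 1 else 0).
Proof.
(* The 4 absorbs the constant [4 ^ 4] of a round, the logarithm its factor [k.+1]; the exponent 2
   comes from reading the matrix. *)
exists program, (fun k => 4 + up_log 2 k.+1), 2.
split=> [|n E k eta sE cE]; first exact: sublinear_log.
set s0 := input E k eta.
have h0 : holds (n * n) (matrix_cell E) (fun=> 0) s0.
  split=> // a; rewrite /= [X in nat_of_bool X](_ : _ = false) //.
  apply/existsP=> -[i /existsP[j /andP[/eqP e _]]].
  by have := ltn_ord i; have := ltn_ord j; nia.
have [t [s [ex lt _ out]]] : wp program ((2 + (n * 3).+1) + ((2 + (k * 4).+1) +
    ((1 + (4 ^ k * (round_time n k).+1).+1) + 1))) s0
    (fun s => output s = balanced_cluster_editing E k eta).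
  apply: (wp_seq (@wp_square n _ _ _ _)) => // s1 u1 [e1 o1 B1].
  apply: (wp_seq (@wp_power k _ _ _ o1)); rewrite ?u1 //.
  move=> s2 u2 [e2 M2].
  apply: (wp_seq (@wp_search n E k eta s2 (fun=> 0) sE cE _ _ _ _ _
    (etrans (u2 rone isT) o1) M2 (etrans (u2 rB isT) B1) _ _));
    rewrite ?u2 // ?u1 //.
    by apply: holds_cells h0 _; rewrite e2.
  move=> s3 u3 a3; apply: wp_den => //=.
  by rewrite /output /= /upd /= a3 u3 // u2 // u1 // addn0.
exists t, s; split=> //; split; last by rewrite out; case: balanced_cluster_editing.
apply: leq_trans lt _.
have k2 : k.+1 <= 4 ^ up_log 2 k.+1.
  apply: leq_trans (up_logP k.+1 (isT : 1 < 2)) _.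
  have -> : 4 ^ up_log 2 k.+1 = 2 ^ (2 * up_log 2 k.+1) by rewrite expnM.
  by rewrite leq_exp2l // leq_pmull.
have p4 : 0 < 4 ^ k by rewrite expn_gt0.
rewrite expnD (expnD 4 4) -mulnA -(mulnA (4 ^ 4)).
apply: (@leq_trans (4 ^ k * (4 ^ 4 * (k.+1 * n.+1 ^ 2)))); last first.
  by do 2![apply: leq_mul; first exact: leqnn]; apply: leq_mul.
apply: leq_trans (leq_mul (leqnn (4 ^ k)) (round_time_bound n k)).
by nia.
Qed.
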